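(* $\mathsf{CD}^+_{\mathrm T,\mathsf{cp}}$ and $\mathsf{CKF}_{\mathsf{cp}}$ are identical theories, i.e. they prove exactly the same $\mathcal L_{\mathrm T}$-sentences.
   Context: **Language and notation.** $\mathcal L_{\mathbb N}$ is the language of arithmetic over $\{\bar 0,\mathrm S,+,\times\}$ with finitely many additional function symbols for elementary syntactic operations: $\mathrm{num}$ (sending $n$ to the code of its numeral) and functions sending codes of expressions to the codes of their negation, conjunction, universal quantification, and the code of a term $t$ to the code of the atomic formula $\mathrm T(t)$, etc. $\mathcal L_{\mathrm T}=\mathcal L_{\mathbb N}\cup\{\mathrm T\}$ with $\mathrm T$ a unary predicate. A Gödel numbering is fixed and expressions are identified with their codes. Logical primitives are $\neg,\wedge,\forall$, the others being defined. In axioms, $s,t$ range over codes of closed terms and $t^\circ$ is the value of $t$; $\varphi,\psi$ range over codes of sentences of $\mathcal L_{\mathrm T}$; $\varphi(v)$ ranges over codes of formulas with at most the variable $v$ free; $\varphi(t/v)$ is substitution. Connectives and predicates inside $\mathrm T$ (or $\mathrm D$) denote the corresponding syntactic operations on codes. $\mathrm F x:=\mathrm T(\neg x)$ (with $\neg$ the syntactic negation function). $\mathrm T\mathrm T\varphi$ and $\mathrm T\mathrm F\varphi$ are $\mathrm T$ applied to the code of $\mathrm T(\mathrm{num}(\varphi))$, resp. of $\mathrm F(\mathrm{num}(\varphi))$. For $t$ a closed term code, $\mathrm T\mathrm T t$ and $\mathrm T\mathrm F t$ are $\mathrm T$ applied to the code of the sentence $\mathrm T(t)$, resp. $\mathrm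 F(t)$; and $\mathrm T\mathrm T\mathrm T t$, $\mathrm T\mathrm F\mathrm T t$ are $\mathrm T\mathrm T\varphi$, $\mathrm T\mathrm F\varphi$ for $\varphi$ the sentence $\mathrm T(t)$. **$\mathsf{CD}^+_{\mathrm T,\mathsf{cp}}$** is the $\mathcal L_{\mathrm T}$-theory consisting of $\mathsf{PA}$ with induction for all $\mathcal L_{\mathrm T}$-formulas and the following axioms, where $\mathrm D$ is defined by $\mathrm D x:\leftrightarrow \neg\mathrm T\mathrm T x\vee\neg\mathrm T\mathrm F x$ (here $\mathrm T\mathrm T x$, $\mathrm T\mathrm F x$ say that $\mathrm T$ holds of the code of $\mathrm T(\mathrm{num}(x))$, resp. of $\mathrm F(\mathrm{num}(x))$), and $\mathrm D t$ inside $\mathrm T$ or $\mathrm D$ is the code of the defining formula applied to $t$: - (T1) $\forall s\forall t(\mathrm T(s=t)\leftrightarrow s^\circ=t^\circ)$ - (T2$^+$) $\forall t(\mathrm D t^\circ\leftrightarrow \mathrm T\mathrm D t)$ - (T3) $\forall t(\mathrm D t^\circ\to(\mathrm T\mathrm T t\leftrightarrow \mathrm T t^\circ))$ - (T4) $\forall\varphi(\mathrm T(\neg\varphi)\leftrightarrow\neg\mathrm T\varphi)$ - (T5) $\forall\varphi,\psi(\mathrm T(\varphi\wedge\psi)\leftrightarrow \mathrm T\varphi\wedge\mathrm T\psi)$ - (T6) $\forall\varphi(v)(\mathrm T(\forall v\varphi)\leftrightarrow\forall t\,\mathrm T\varphi(t/v))$ - (D1) $\forall s\forall t\,\mathrm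 D(s=t)$ - (D2) $\forall t(\mathrm D\mathrm T t\leftrightarrow\mathrm D t^\circ)$ - (D3) $\forall t(\mathrm D\mathrm D t\leftrightarrow\mathrm D t^\circ)$ - (D4) $\forall\varphi(\mathrm D(\neg\varphi)\leftrightarrow\mathrm D\varphi)$ - (D5) $\forall\varphi,\psi\big(\mathrm D(\varphi\wedge\psi)\leftrightarrow((\mathrm D\varphi\wedge\mathrm D\psi)\vee(\mathrm D\varphi\wedge\mathrm T\neg\varphi)\vee(\mathrm D\psi\wedge\mathrm T\neg\psi))\big)$ - (D6) $\forall\varphi(v)\big(\mathrm D(\forall v\varphi)\leftrightarrow(\forall t\,\mathrm D\varphi(t/v)\vee\exists t(\mathrm D\varphi(t/v)\wedge\mathrm T\neg\varphi(t/v)))\big)$ - (R1) $\forall\varphi(v)\forall s\forall t(s^\circ=t^\circ\to(\mathrm T\varphi(s)\leftrightarrow\mathrm T\varphi(t)))$ - (R2) $\forall\varphi(v)\forall s\forall t(s^\circ=t^\circ\to(\mathrm D\varphi(s)\leftrightarrow\mathrm D\varphi(t)))$ **$\mathsf{CKF}_{\mathsf{cp}}$** is the $\mathcal L_{\mathrm T}$-theory consisting of $\mathsf{PA}$ with induction for all $\mathcal L_{\mathrm T}$-formulas, the axioms (T1), (T4), (T5), (T6), (R1) above, and: - (T7) $\forall s\forall t(\mathrm T\mathrm T(s=t)\leftrightarrow s^\circ=t^\circ)$ - (T8) $\forall s\forall t(\mathrm T\mathrm F(s=t)\leftrightarrow s^\circ\neq t^\circ)$ - (T9) $\forall\varphi(\mathrm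 T\mathrm T\varphi\leftrightarrow\mathrm T\mathrm T\neg\neg\varphi)$ - (T10) $\forall\varphi,\psi(\mathrm T\mathrm T(\varphi\wedge\psi)\leftrightarrow\mathrm T\mathrm T\varphi\wedge\mathrm T\mathrm T\psi)$ - (T11) $\forall\varphi,\psi(\mathrm T\mathrm F(\varphi\wedge\psi)\leftrightarrow\mathrm T\mathrm F\varphi\vee\mathrm T\mathrm F\psi)$ - (T12) $\forall\varphi(v)(\mathrm T\mathrm T(\forall v\varphi)\leftrightarrow\mathrm T(\forall t\,\mathrm T\varphi(t/v)))$ - (T13) $\forall\varphi(v)(\mathrm T\mathrm F(\forall v\varphi)\leftrightarrow\mathrm T(\exists t\,\mathrm F\varphi(t/v)))$ - (T14) $\forall t(\mathrm T\mathrm T\mathrm T t\leftrightarrow\mathrm T\mathrm T t)$ - (T15) $\forall t(\mathrm T\mathrm F\mathrm T t\leftrightarrow\mathrm T\mathrm F t)$ - (TRep) $\forall t(\mathrm T t^\circ\to\mathrm T\mathrm T t)$ In (T12), (T13), $\forall t\,\mathrm T\varphi(t/v)$ and $\exists t\,\mathrm F\varphi(t/v)$ under the outer $\mathrm T$ denote the code of the sentence ''for all closed terms $t$, $\mathrm T\varphi(t/v)$'', resp. ''for some closed term $t$, $\mathrm F\varphi(t/v)$''.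
   Formalization: The syntactic negation function is taken to send every number that is not a sentence (open formulas included) to the code of 0=0, so F holds of non-sentences; with purely syntactic negation there, CKF does not prove (T3) and the claim fails. *)

(* Defs.v *)
From Stdlib Require Import List.
Import ListNotations.

(* L_N has 0, S, +, * and finitely many further symbols for operations on
   codes: pairing, the numeral function, the formation of T(t), of negations,
   universal quantifications, equations and conjunctions, the characteristic
   functions of the sets of (codes of) terms and of formulas, the number of
   free occurrences of a variable, substitution, and projection from a finite
   sequence.  Each is governed by defining equations in [PA] below. *)
Inductive un_sym : Set := sS | sNum | sTdot | sNeg | sAll | sTm | sFm.
Inductive bin_sym : Set := sAdd | sMul | sPair | sEqn | sConj | sOcc | sNth.

(* Variables are de Bruijn indices; [All] binds index 0. *)
Inductive term : Set :=
| Var (n : nat)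
| Zero
| Un (f : un_sym) (a : term)
| Bin (f : bin_sym) (a b : term)
| Sub (a b c : term).

Inductive form : Set :=
| Eqn (a b : term)
| Tr (a : term)
| Neg (A : form)
| Conj (A B : form)
| All (A : form).

Fixpoint term_below (n : nat) (t : term) : Prop :=
  match t with
  | Var i => i < n
  | Zero => True
  | Un _ a => term_below n a
  | Bin _ a b => term_below n a /\ term_below n b
  | Sub a b c => term_below n a /\ term_below n b /\ term_below n c
  end.

Fixpoint form_below (n : nat) (A : form) : Prop :=
  match A with
  | Eqn a b => term_below n a /\ term_below n b
  | Tr a => term_below n a
  | Neg A => form_below n A
  | Conj A B => form_below n A /\ form_below n B
  | All A => form_below (S n) A
  end.

Definition sentence (A : form) : Prop := form_below 0 A.

Fixpoint subst_term (s : nat -> term) (t : term) : term :=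
  match t with
  | Var i => s i
  | Zero => Zero
  | Un f a => Un f (subst_term s a)
  | Bin f a b => Bin f (subst_term s a) (subst_term s b)
  | Sub a b c => Sub (subst_term s a) (subst_term s b) (subst_term s c)
  end.

Definition shift (i : nat) : term := Var (S i).

Definition up (s : nat -> term) (i : nat) : term :=
  match i with
  | 0 => Var 0
  | S j => subst_term shift (s j)
  end.

Fixpoint subst_form (s : nat -> term) (A : form) : form :=
  match A with
  | Eqn a b => Eqn (subst_term s a) (subst_term s b)
  | Tr a => Tr (subst_term s a)
  | Neg A => Neg (subst_form s A)
  | Conj A B => Conj (subst_form s A) (subst_form s B)
  | All A => All (subst_form (up s) A)
  end.

Definition inst (t : term) (i : nat) : term :=
  match i with
  | 0 => t
  | S j => Var j
  end.

Definition Or (A B : form) : form := Neg (Conj (Neg A) (Neg B)).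
Definition Imp (A B : form) : form := Neg (Conj A (Neg B)).
Definition Iff (A B : form) : form := Conj (Imp A B) (Imp B A).
Definition Ex (A : form) : form := Neg (All (Neg A)).

Fixpoint numeral (n : nat) : term :=
  match n with
  | 0 => Zero
  | S m => Un sS (numeral m)
  end.

Inductive nd : list form -> form -> Prop :=
| nd_hyp G A : In A G -> nd G A
| nd_neg_intro G A B : nd (A :: G) B -> nd (A :: G) (Neg B) -> nd G (Neg A)
| nd_raa G A B : nd (Neg A :: G) B -> nd (Neg A :: G) (Neg B) -> nd G A
| nd_conj_intro G A B : nd G A -> nd G B -> nd G (Conj A B)
| nd_conj_elim_l G A B : nd G (Conj A B) -> nd G A
| nd_conj_elim_r G A B : nd G (Conj A B) -> nd G B
| nd_all_intro G A : nd (map (subst_form shift) G) A -> nd G (All A)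
| nd_all_elim G A t : nd G (All A) -> nd G (subst_form (inst t) A)
| nd_eq_refl G t : nd G (Eqn t t)
| nd_eq_subst G A s t :
    nd G (Eqn s t) -> nd G (subst_form (inst s) A) -> nd G (subst_form (inst t) A).

Definition theory := form -> Prop.

Definition proves (Th : theory) (A : form) : Prop :=
  exists G, (forall B, In B G -> Th B) /\ nd G A.

(* An [lterm] ([lform]) is a term (formula) as a function of the number [d]
   of quantifiers it stands under.  The variable introduced by the quantifier
   at level [d] has, under [e] quantifiers, the index [e - d - 1]; thus object
   quantifiers can be written with Rocq binders and no shifting is needed. *)
Definition lterm := nat -> term.
Definition lform := nat -> form.

Definition lZero : lterm := fun _ => Zero.
Definition lUn (f : un_sym) (a : lterm) : lterm := fun d => Un f (a d).
Definition lBin (f : bin_sym) (a b : lterm) : lterm := fun d => Bin f (a d) (b d).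
Definition lSub (a b c : lterm) : lterm := fun d => Sub (a d) (b d) (c d).
Definition lnum (n : nat) : lterm := fun _ => numeral n.

Definition lEqn (a b : lterm) : lform := fun d => Eqn (a d) (b d).
Definition lTr (a : lterm) : lform := fun d => Tr (a d).
Definition lNeg (A : lform) : lform := fun d => Neg (A d).
Definition lConj (A B : lform) : lform := fun d => Conj (A d) (B d).
Definition lOr (A B : lform) : lform := fun d => Or (A d) (B d).
Definition lImp (A B : lform) : lform := fun d => Imp (A d) (B d).
Definition lIff (A B : lform) : lform := fun d => Iff (A d) (B d).
Definition lAll (A : lterm -> lform) : lform :=
  fun d => All (A (fun e => Var (e - S d)) (S d)).
Definition lEx (A : lterm -> lform) : lform :=
  fun d => Ex (A (fun e => Var (e - S d)) (S d)).

Definition close (A : lform) : form := A 0.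

(* The formula whose only free variable is index 0, put for the argument. *)
Definition open1 (A : lterm -> lform) : form := A (fun e => Var e) 0.

Declare Scope lform_scope.
Delimit Scope lform_scope with lf.
Bind Scope lform_scope with lform.
Bind Scope lform_scope with lterm.
Notation "a ≐ b" := (lEqn a b) (at level 70) : lform_scope.
Notation "¬ A" := (lNeg A) (at level 75, right associativity) : lform_scope.
Notation "A ∧ B" := (lConj A B) (at level 80, right associativity) : lform_scope.
Notation "A ∨ B" := (lOr A B) (at level 85, right associativity) : lform_scope.
Notation "A ⇒ B" := (lImp A B) (at level 90, right associativity) : lform_scope.
Notation "A ⇔ B" := (lIff A B) (at level 95, no associativity) : lform_scope.
Notation "∀ x .. y , A" := (lAll (fun x => .. (lAll (fun y => A)) ..))
  (at level 200, x binder, y binder, right associativity) : lform_scope.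
Notation "∃ x .. y , A" := (lEx (fun x => .. (lEx (fun y => A)) ..))
  (at level 200, x binder, y binder, right associativity) : lform_scope.
Notation "a ⊕ b" := (lBin sAdd a b) (at level 50, left associativity) : lform_scope.
Notation "a ⊗ b" := (lBin sMul a b) (at level 40, left associativity) : lform_scope.
Open Scope lform_scope.

Definition lS : lterm -> lterm := lUn sS.
Definition num : lterm -> lterm := lUn sNum.
Definition tdot : lterm -> lterm := lUn sTdot.
Definition negdot : lterm -> lterm := lUn sNeg.
Definition alldot : lterm -> lterm := lUn sAll.
Definition tm : lterm -> lterm := lUn sTm.
Definition fm : lterm -> lterm := lUn sFm.
Definition lpair : lterm -> lterm -> lterm := lBin sPair.
Definition eqdot : lterm -> lterm -> lterm := lBin sEqn.
Definition conjdot : lterm -> lterm -> lterm := lBin sConj.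
(* [occ v x]: number of free occurrences of the [v]-th variable in [x]. *)
Definition occ : lterm -> lterm -> lterm := lBin sOcc.
Definition proj : lterm -> lterm -> lterm := lBin sNth.
(* [sub x v t]: the result of replacing the [v]-th variable in [x] by the
   closed term [t].  Other variables keep their indices. *)
Definition sub : lterm -> lterm -> lterm -> lterm := lSub.

(* Codes are built with the pairing function [lpair], which is injective (see
   [pa_pair]).  Every code has a tag >= 1 as first component, so an expression
   has a larger code than its immediate parts, and the forms below do not
   overlap. *)
Definition tag_eqn := 1.
Definition tag_tr := 2.
Definition tag_neg := 3.
Definition tag_conj := 4.
Definition tag_all := 5.
Definition tag_var := 6.
Definition tag_zero := 7.
Definition tag_sub := 8.
Definition tag_un (f : un_sym) : nat :=
  match f with
  | sS => 9 | sNum => 10 | sTdot => 11 | sNeg => 12 | sAll => 13 | sTm => 14 | sFm => 15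
  end.
Definition tag_bin (f : bin_sym) : nat :=
  match f with
  | sAdd => 16 | sMul => 17 | sPair => 18 | sEqn => 19 | sConj => 20 | sOcc => 21 | sNth => 22
  end.

Definition cVar (i : lterm) : lterm := lpair (lnum tag_var) i.
Definition cZero : lterm := lpair (lnum tag_zero) lZero.
Definition cUn (f : un_sym) (a : lterm) : lterm := lpair (lnum (tag_un f)) a.
Definition cBin (f : bin_sym) (a b : lterm) : lterm := lpair (lnum (tag_bin f)) (lpair a b).
Definition cSub (a b c : lterm) : lterm := lpair (lnum tag_sub) (lpair a (lpair b c)).
Definition cEqn (a b : lterm) : lterm := lpair (lnum tag_eqn) (lpair a b).
Definition cTr (a : lterm) : lterm := lpair (lnum tag_tr) a.
Definition cNeg (x : lterm) : lterm := lpair (lnum tag_neg) x.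
Definition cConj (x y : lterm) : lterm := lpair (lnum tag_conj) (lpair x y).
Definition cAll (x : lterm) : lterm := lpair (lnum tag_all) x.

(* The Gödel code, as an L_N-term, of an expression standing under [k]
   quantifiers whose free variable is replaced by the closed term coded by
   [c].  On closed expressions [c] is irrelevant and this is the Gödel code
   itself. *)
Fixpoint quote_term (c : lterm) (k : nat) (t : term) : lterm :=
  match t with
  | Var i => if Nat.ltb i k then cVar (lnum i) else c
  | Zero => cZero
  | Un f a => cUn f (quote_term c k a)
  | Bin f a b => cBin f (quote_term c k a) (quote_term c k b)
  | Sub a b e => cSub (quote_term c k a) (quote_term c k b) (quote_term c k e)
  end.

Fixpoint quote_form (c : lterm) (k : nat) (A : form) : lterm :=
  match A with
  | Eqn a b => cEqn (quote_term c k a) (quote_term c k b)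
  | Tr a => cTr (quote_term c k a)
  | Neg A => cNeg (quote_form c k A)
  | Conj A B => cConj (quote_form c k A) (quote_form c k B)
  | All A => cAll (quote_form c (S k) A)
  end.

(* The code of the sentence A(t), where [c] is the code of the closed term t. *)
Definition quote (A : lterm -> lform) (c : lterm) : lterm := quote_form c 0 (open1 A).

Definition ClTerm (x : lterm) : lform :=
  tm x ≐ lnum 1 ∧ ∀ v, occ v x ≐ lZero.
Definition Sent (x : lterm) : lform :=
  fm x ≐ lnum 1 ∧ ∀ v, occ v x ≐ lZero.
Definition Form1 (v x : lterm) : lform :=
  fm x ≐ lnum 1 ∧ ∀ w, ¬ occ w x ≐ lZero ⇒ w ≐ v.

Definition all_un : list un_sym := [sS; sNum; sTdot; sNeg; sAll; sTm; sFm].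
Definition all_bin : list bin_sym := [sAdd; sMul; sPair; sEqn; sConj; sOcc; sNth].

Definition disj_un (A : un_sym -> lform) (B : lform) : lform :=
  fold_right (fun f C => A f ∨ C) B all_un.
Definition disj_bin (A : bin_sym -> lform) (B : lform) : lform :=
  fold_right (fun f C => A f ∨ C) B all_bin.

Definition TermShape (x : lterm) : lform :=
  disj_un (fun f => ∃ a, x ≐ cUn f a)
  (disj_bin (fun f => ∃ a b, x ≐ cBin f a b)
  ((∃ i, x ≐ cVar i) ∨ x ≐ cZero ∨ (∃ a b c, x ≐ cSub a b c))).
Definition FormShape (x : lterm) : lform :=
  (∃ a b, x ≐ cEqn a b) ∨ (∃ a, x ≐ cTr a) ∨ (∃ y, x ≐ cNeg y)
  ∨ (∃ y z, x ≐ cConj y z) ∨ (∃ y, x ≐ cAll y).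

(* Value of a closed term.  It cannot be a function symbol, so it is defined
   by the existence of a sequence of pairs (t, y) closed under the evaluation
   clauses.  Entries are shifted by one since 0 marks the end of a sequence. *)
Definition Entry (s t y : lterm) : lform := ∃ i, proj s i ≐ lS (lpair t y).
Definition EvalClause (s t y : lterm) : lform :=
  disj_un (fun f => ∃ a x, t ≐ cUn f a ∧ y ≐ lUn f x ∧ Entry s a x)
  (disj_bin (fun f => ∃ a b x z,
      t ≐ cBin f a b ∧ y ≐ lBin f x z ∧ Entry s a x ∧ Entry s b z)
  ((t ≐ cZero ∧ y ≐ lZero)
   ∨ (∃ a b c x z w, t ≐ cSub a b c ∧ y ≐ lSub x z w
        ∧ Entry s a x ∧ Entry s b z ∧ Entry s c w))).
Definition Val (t y : lterm) : lform :=
  ∃ s, (∀ u z, Entry s u z ⇒ EvalClause s u z) ∧ Entry s t y.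

Definition ind_instance (A : form) : form :=
  Imp (Conj (subst_form (inst Zero) A)
            (All (Imp A (subst_form (fun i => match i with
                                              | 0 => Un sS (Var 0)
                                              | S j => Var (S j)
                                              end) A))))
      (All A).

Fixpoint alls (n : nat) (A : form) : form :=
  match n with
  | 0 => A
  | S m => All (alls m A)
  end.

Inductive PA : theory :=
| pa_S_zero : PA (close (∀ x, ¬ lS x ≐ lZero))
| pa_S_inj : PA (close (∀ x y, lS x ≐ lS y ⇒ x ≐ y))
| pa_add_zero : PA (close (∀ x, x ⊕ lZero ≐ x))
| pa_add_S : PA (close (∀ x y, x ⊕ lS y ≐ lS (x ⊕ y)))
| pa_mul_zero : PA (close (∀ x, x ⊗ lZero ≐ lZero))
| pa_mul_S : PA (close (∀ x y, x ⊗ lS y ≐ x ⊗ y ⊕ x))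
| pa_ind n A : sentence (alls n (ind_instance A)) -> PA (alls n (ind_instance A))
(* pairing: a <= a + b, so (a + b)^2 + a determines a + b and a *)
| pa_pair : PA (close (∀ a b, lpair a b ≐ (a ⊕ b) ⊗ (a ⊕ b) ⊕ a))
| pa_num_zero : PA (close (num lZero ≐ cZero))
| pa_num_S : PA (close (∀ x, num (lS x) ≐ cUn sS (num x)))
| pa_eqn : PA (close (∀ s t, eqdot s t ≐ cEqn s t))
| pa_tdot : PA (close (∀ t, tdot t ≐ cTr t))
| pa_conj : PA (close (∀ x y, conjdot x y ≐ cConj x y))
| pa_all : PA (close (∀ x, alldot x ≐ cAll x))
| pa_neg : PA (close (∀ x, Sent x ⇒ negdot x ≐ cNeg x))
(* On other arguments the value is the code of 0 = 0, so that F x holds: what is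
   not a sentence counts as false.  [negdot] is only applied to sentences, except
   in the definition of D and where T(t), F(t) are formed for arbitrary closed
   terms t; codes of negated open formulas are formed with [cNeg]. *)
| pa_neg_default : PA (close (∀ x, ¬ Sent x ⇒ negdot x ≐ cEqn cZero cZero))
| pa_tm_var : PA (close (∀ i, tm (cVar i) ≐ lnum 1))
| pa_tm_zero : PA (close (tm cZero ≐ lnum 1))
| pa_tm_un f : PA (close (∀ a, tm (cUn f a) ≐ tm a))
| pa_tm_bin f : PA (close (∀ a b, tm (cBin f a b) ≐ tm a ⊗ tm b))
| pa_tm_sub : PA (close (∀ a b c, tm (cSub a b c) ≐ tm a ⊗ tm b ⊗ tm c))
| pa_tm_default : PA (close (∀ x, ¬ TermShape x ⇒ tm x ≐ lZero))
| pa_fm_eqn : PA (close (∀ a b, fm (cEqn a b) ≐ tm a ⊗ tm b))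
| pa_fm_tr : PA (close (∀ a, fm (cTr a) ≐ tm a))
| pa_fm_neg : PA (close (∀ x, fm (cNeg x) ≐ fm x))
| pa_fm_conj : PA (close (∀ x y, fm (cConj x y) ≐ fm x ⊗ fm y))
| pa_fm_all : PA (close (∀ x, fm (cAll x) ≐ fm x))
| pa_fm_default : PA (close (∀ x, ¬ FormShape x ⇒ fm x ≐ lZero))
| pa_occ_var_same : PA (close (∀ v, occ v (cVar v) ≐ lnum 1))
| pa_occ_var_other : PA (close (∀ v i, ¬ i ≐ v ⇒ occ v (cVar i) ≐ lZero))
| pa_occ_zero : PA (close (∀ v, occ v cZero ≐ lZero))
| pa_occ_un f : PA (close (∀ v a, occ v (cUn f a) ≐ occ v a))
| pa_occ_bin f : PA (close (∀ v a b, occ v (cBin f a b) ≐ occ v a ⊕ occ v b))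
| pa_occ_sub :
    PA (close (∀ v a b c, occ v (cSub a b c) ≐ occ v a ⊕ occ v b ⊕ occ v c))
| pa_occ_eqn : PA (close (∀ v a b, occ v (cEqn a b) ≐ occ v a ⊕ occ v b))
| pa_occ_tr : PA (close (∀ v a, occ v (cTr a) ≐ occ v a))
| pa_occ_neg : PA (close (∀ v x, occ v (cNeg x) ≐ occ v x))
| pa_occ_conj : PA (close (∀ v x y, occ v (cConj x y) ≐ occ v x ⊕ occ v y))
| pa_occ_all : PA (close (∀ v x, occ v (cAll x) ≐ occ (lS v) x))
| pa_occ_default :
    PA (close (∀ v x, ¬ (TermShape x ∨ FormShape x) ⇒ occ v x ≐ lZero))
| pa_sub_var_same : PA (close (∀ v t, sub (cVar v) v t ≐ t))
| pa_sub_var_other : PA (close (∀ v t i, ¬ i ≐ v ⇒ sub (cVar i) v t ≐ cVar i))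
| pa_sub_zero : PA (close (∀ v t, sub cZero v t ≐ cZero))
| pa_sub_un f : PA (close (∀ v t a, sub (cUn f a) v t ≐ cUn f (sub a v t)))
| pa_sub_bin f :
    PA (close (∀ v t a b, sub (cBin f a b) v t ≐ cBin f (sub a v t) (sub b v t)))
| pa_sub_sub :
    PA (close (∀ v t a b c,
      sub (cSub a b c) v t ≐ cSub (sub a v t) (sub b v t) (sub c v t)))
| pa_sub_eqn :
    PA (close (∀ v t a b, sub (cEqn a b) v t ≐ cEqn (sub a v t) (sub b v t)))
| pa_sub_tr : PA (close (∀ v t a, sub (cTr a) v t ≐ cTr (sub a v t)))
| pa_sub_neg : PA (close (∀ v t x, sub (cNeg x) v t ≐ cNeg (sub x v t)))
| pa_sub_conj :
    PA (close (∀ v t x y, sub (cConj x y) v t ≐ cConj (sub x v t) (sub y v t)))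
| pa_sub_all : PA (close (∀ v t x, sub (cAll x) v t ≐ cAll (sub x (lS v) t)))
| pa_sub_default :
    PA (close (∀ v t x, ¬ (TermShape x ∨ FormShape x) ⇒ sub x v t ≐ x))
(* finite sequences: 0 is empty, S (lpair a r) has head a and tail r *)
| pa_nth_head : PA (close (∀ a r, proj (lS (lpair a r)) lZero ≐ a))
| pa_nth_tail : PA (close (∀ a r i, proj (lS (lpair a r)) (lS i) ≐ proj r i))
| pa_nth_default :
    PA (close (∀ s i, ¬ (∃ a r, s ≐ lS (lpair a r)) ⇒ proj s i ≐ lZero)).

Definition allTerm (A : lterm -> lform) : lform := ∀ t, ClTerm t ⇒ A t.
Definition exTerm (A : lterm -> lform) : lform := ∃ t, ClTerm t ∧ A t.
(* Quantification over closed terms [t] together with their value t°. *)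
Definition allTermVal (A : lterm -> lterm -> lform) : lform :=
  ∀ t, ClTerm t ⇒ ∀ y, Val t y ⇒ A t y.
Definition allSent (A : lterm -> lform) : lform := ∀ x, Sent x ⇒ A x.
Definition allForm1 (v : lterm) (A : lterm -> lform) : lform := ∀ x, Form1 v x ⇒ A x.

Definition T (x : lterm) : lform := lTr x.
Definition F (x : lterm) : lform := T (negdot x).

(* Codes of T(t) and F(t), for [t] the code of a closed term. *)
Definition cT (t : lterm) : lterm := tdot t.
Definition cF (t : lterm) : lterm := quote F t.

(* T and F under T, applied to a code of a closed term ... *)
Definition TTt (t : lterm) : lform := T (cT t).
Definition TFt (t : lterm) : lform := T (cF t).
(* ... and to a number, via its numeral. *)
Definition TT (x : lterm) : lform := TTt (num x).
Definition TF (x : lterm) : lform := TFt (num x).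

Definition D (x : lterm) : lform := ¬ TT x ∨ ¬ TF x.
Definition cD (t : lterm) : lterm := quote D t.

Definition T1 : form := close
  (allTermVal (fun s vs => allTermVal (fun t vt => T (eqdot s t) ⇔ vs ≐ vt))).
Definition T2plus : form := close
  (allTermVal (fun t vt => D vt ⇔ T (cD t))).
Definition T3 : form := close
  (allTermVal (fun t vt => D vt ⇒ (TTt t ⇔ T vt))).
Definition T4 : form := close
  (allSent (fun x => T (negdot x) ⇔ ¬ T x)).
Definition T5 : form := close
  (allSent (fun x => allSent (fun y => T (conjdot x y) ⇔ T x ∧ T y))).
Definition T6 : form := close
  (allForm1 lZero (fun x => T (alldot x) ⇔ allTerm (fun t => T (sub x lZero t)))).

Definition D1 : form := close
  (allTerm (fun s => allTerm (fun t => D (eqdot s t)))).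
Definition D2 : form := close
  (allTermVal (fun t vt => D (cT t) ⇔ D vt)).
Definition D3 : form := close
  (allTermVal (fun t vt => D (cD t) ⇔ D vt)).
Definition D4 : form := close
  (allSent (fun x => D (negdot x) ⇔ D x)).
Definition D5 : form := close
  (allSent (fun x => allSent (fun y =>
     D (conjdot x y) ⇔ (D x ∧ D y) ∨ (D x ∧ T (negdot x)) ∨ (D y ∧ T (negdot y))))).
Definition D6 : form := close
  (allForm1 lZero (fun x =>
     D (alldot x) ⇔ allTerm (fun t => D (sub x lZero t))
                 ∨ exTerm (fun t => D (sub x lZero t) ∧ T (negdot (sub x lZero t))))).

Definition R1 : form := close
  (∀ v, allForm1 v (fun x => allTermVal (fun s vs => allTermVal (fun t vt =>
     vs ≐ vt ⇒ (T (sub x v s) ⇔ T (sub x v t)))))).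
Definition R2 : form := close
  (∀ v, allForm1 v (fun x => allTermVal (fun s vs => allTermVal (fun t vt =>
     vs ≐ vt ⇒ (D (sub x v s) ⇔ D (sub x v t)))))).

Definition T7 : form := close
  (allTermVal (fun s vs => allTermVal (fun t vt => TT (eqdot s t) ⇔ vs ≐ vt))).
Definition T8 : form := close
  (allTermVal (fun s vs => allTermVal (fun t vt => TF (eqdot s t) ⇔ ¬ vs ≐ vt))).
Definition T9 : form := close
  (allSent (fun x => TT x ⇔ TT (negdot (negdot x)))).
Definition T10 : form := close
  (allSent (fun x => allSent (fun y => TT (conjdot x y) ⇔ TT x ∧ TT y))).
Definition T11 : form := close
  (allSent (fun x => allSent (fun y => TF (conjdot x y) ⇔ TF x ∨ TF y))).
(* The formula [x] occurs in the inner sentence through its numeral. *)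
Definition T12 : form := close
  (allForm1 lZero (fun x =>
     TT (alldot x) ⇔ T (quote (fun c => allTerm (fun t => T (sub c lZero t))) (num x)))).
Definition T13 : form := close
  (allForm1 lZero (fun x =>
     TF (alldot x) ⇔ T (quote (fun c => exTerm (fun t => F (sub c lZero t))) (num x)))).
Definition T14 : form := close
  (allTerm (fun t => TT (cT t) ⇔ TTt t)).
Definition T15 : form := close
  (allTerm (fun t => TF (cT t) ⇔ TFt t)).
Definition TRep : form := close
  (allTermVal (fun t vt => T vt ⇒ TTt t)).

Definition CDplus : theory := fun A =>
  PA A \/
  In A [T1; T2plus; T3; T4; T5; T6; D1; D2; D3; D4; D5; D6; R1; R2].

Definition CKF : theory := fun A =>
  PA A \/
  In A [T1; T4; T5; T6; R1;
        T7; T8; T9; T10; T11; T12; T13; T14; T15; TRep].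

(* Main.v *)
From Stdlib Require Import List Lia PeanoNat Cantor Classical ClassicalEpsilon
  FunctionalExtensionality PropExtensionality ProofIrrelevance Ring Bool.
Import ListNotations.
Require Import Defs.
Close Scope lform_scope.

(** The two theories have the same models, hence by completeness the same
theorems.  Derivability is therefore never handled inside the calculus: a Henkin
construction ([completeness]) reduces the claim to [CKF_models_CDplus] and
[CDplus_models_CKF], and these are proved by ordinary reasoning about a model [M]
of PA with a predicate [tru] on codes.  Induction inside [M] is available for
predicates defined by a formula; the formula is found by the tactic [sem].

In [M] write TT x and TF x for [TTof x] and [TFof x], and D x for [det x], that is,
not both TT x and TF x.  By regularity [R1], truth of the code of T(t) or F(t)
depends only on the value of the closed term t ([TTtm_val], [TFtm_val]); in
particular TF x amounts to TT of the negation of x.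

From CKF to CD.  By TRep, T x implies TT x.  As outer truth is complete and
consistent, every x has TT x or TF x, and if only one of them holds then it agrees
with outer truth ([det_TTof]).  So D x and T(not x) together say that TT x fails
([det_refuted]), and the D-axioms become propositional consequences of the
compositional clauses for TT and TF.  Regularity of D is the exception: it
requires regularity of inner truth, proved by induction on formulas
([inner_regular]).

From CD to CKF.  Every x is either determinate, and then TT x is equivalent to
T x and, for sentences, TF x to T(not x) ([det_TT], [det_TF]), or it has both TT x
and TF x ([not_det]).  In each case the axioms for D say which case the compound falls
under, and the clause for inner truth follows from the one for outer truth or holds
because both of its sides do.

In both directions truth of a quoted formula has to be evaluated, as for the
codes under T in T2, T12 and T13.  [tru_qform] does this once for all formulas:
outer truth of the code of A is satisfaction of A with T read as TT.  It needs that
all closed terms, including those with nonstandard codes, have a value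
([val_total]). *)

(** * Substitution *)

Definition scons {X : Type} (x : X) (f : nat -> X) (i : nat) : X :=
  match i with 0 => x | S j => f j end.

Lemma subst_term_var t : subst_term Var t = t.
Proof. induction t; cbn; congruence. Qed.

Lemma up_var : up Var = Var.
Proof. extensionality i; destruct i; reflexivity. Qed.

Lemma subst_form_var A : subst_form Var A = A.
Proof.
  induction A; cbn; rewrite ?subst_term_var, ?up_var; congruence.
Qed.

Lemma subst_term_comp s s' t :
  subst_term s' (subst_term s t) = subst_term (fun i => subst_term s' (s i)) t.
Proof. induction t; cbn; congruence. Qed.

Lemma up_comp s s' :
  (fun i => subst_term (up s') (up s i)) = up (fun i => subst_term s' (s i)).
Proof.
  extensionality i; destruct i as [|i]; cbn; auto.
  now rewrite !subst_term_comp.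
Qed.

Lemma subst_form_comp s s' A :
  subst_form s' (subst_form s A) = subst_form (fun i => subst_term s' (s i)) A.
Proof.
  revert s s'; induction A; cbn; intros;
    rewrite ?subst_term_comp, ?IHA, ?IHA1, ?IHA2; try reflexivity.
  f_equal; f_equal; apply up_comp.
Qed.

Lemma subst_inst s t A :
  subst_form s (subst_form (inst t) A)
  = subst_form (inst (subst_term s t)) (subst_form (up s) A).
Proof.
  rewrite !subst_form_comp; f_equal; extensionality i; destruct i as [|i]; cbn; auto.
  rewrite subst_term_comp; symmetry; apply subst_term_var.
Qed.

Lemma subst_shift s A :
  subst_form (up s) (subst_form shift A) = subst_form shift (subst_form s A).
Proof. now rewrite !subst_form_comp. Qed.

Lemma subst_inst_up s t A :
  subst_form (inst t) (subst_form (up s) A) = subst_form (scons t s) A.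
Proof.
  rewrite subst_form_comp; f_equal; extensionality i; destruct i as [|i]; cbn; auto.
  rewrite subst_term_comp; apply subst_term_var.
Qed.

Lemma subst_term_below n s s' t :
  term_below n t -> (forall i, i < n -> s i = s' i) -> subst_term s t = subst_term s' t.
Proof. induction t; cbn; intuition (f_equal; auto). Qed.

Lemma subst_form_below n s s' A :
  form_below n A -> (forall i, i < n -> s i = s' i) -> subst_form s A = subst_form s' A.
Proof.
  revert n s s'; induction A; cbn; intros n s s' H E;
    try solve [f_equal; intuition eauto using subst_term_below].
  f_equal; apply IHA with (1 := H); intros [|i] Hi; cbn; auto.
  rewrite E; auto; lia.
Qed.

Lemma term_below_mono n m t : n <= m -> term_below n t -> term_below m t.
Proof. intro; induction t; cbn; intuition lia. Qed.

Lemma form_below_mono A : forall n m, n <= m -> form_below n A -> form_below m A.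
Proof.
  induction A; cbn; intros n m H; try (intuition eauto using term_below_mono; fail).
  apply IHA; lia.
Qed.

Lemma term_below_ex t : exists n, term_below n t.
Proof.
  induction t as [i| |f a [n Hn]|f a [n Hn] b [m Hm]|a [n Hn] b [m Hm] c [k Hk]]; cbn.
  - exists (S i); lia.
  - now exists 0.
  - now exists n.
  - exists (n + m); split; (eapply term_below_mono; [|eassumption]; lia).
  - exists (n + m + k); repeat split; (eapply term_below_mono; [|eassumption]; lia).
Qed.

Lemma form_below_ex A : exists n, form_below n A.
Proof.
  induction A as [a b|a|A [n Hn]|A [n Hn] B [m Hm]|A [n Hn]]; cbn.
  - destruct (term_below_ex a) as [n Hn], (term_below_ex b) as [m Hm].
    exists (n + m); split; (eapply term_below_mono; [|eassumption]; lia).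
  - apply term_below_ex.
  - eauto.
  - exists (n + m); split; (eapply form_below_mono; [|eassumption]; lia).
  - exists n; eapply form_below_mono; [|eassumption]; lia.
Qed.

Lemma list_below_ex L : exists n, forall A, In A L -> form_below n A.
Proof.
  induction L as [|B L [n Hn]].
  - now exists 0.
  - destruct (form_below_ex B) as [m Hm]; exists (n + m); intros A [<-|HA];
      (eapply form_below_mono; [|eauto]; lia).
Qed.

(** * Derivations *)

Lemma nd_weak G A : nd G A -> forall G', incl G G' -> nd G' A.
Proof.
  induction 1; intros G' HG.
  - apply nd_hyp; auto.
  - eapply nd_neg_intro; [apply IHnd1|apply IHnd2]; (intros C [<-|HC]; [now left|right; auto]).
  - eapply nd_raa; [apply IHnd1|apply IHnd2]; (intros C [<-|HC]; [now left|right; auto]).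
  - apply nd_conj_intro; auto.
  - eapply nd_conj_elim_l; eauto.
  - eapply nd_conj_elim_r; eauto.
  - apply nd_all_intro, IHnd, incl_map, HG.
  - apply nd_all_elim; auto.
  - apply nd_eq_refl.
  - eapply nd_eq_subst; eauto.
Qed.

Lemma nd_subst G A : nd G A -> forall s, nd (map (subst_form s) G) (subst_form s A).
Proof.
  induction 1; intros q; cbn in *.
  - apply nd_hyp, in_map; auto.
  - eapply nd_neg_intro; eauto.
  - eapply nd_raa; eauto.
  - apply nd_conj_intro; auto.
  - eapply nd_conj_elim_l; eauto.
  - eapply nd_conj_elim_r; eauto.
  - apply nd_all_intro. specialize (IHnd (up q)).
    rewrite map_map in IHnd |- *.
    erewrite map_ext in IHnd; [exact IHnd|]. intro; apply subst_shift.
  - rewrite subst_inst; apply nd_all_elim; auto.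
  - apply nd_eq_refl.
  - rewrite subst_inst. eapply nd_eq_subst; [apply IHnd1|].
    rewrite <- subst_inst; apply IHnd2.
Qed.

(** A variable that does not occur in the hypotheses plays the role of a new
constant: renaming it to index 0 and shifting all others turns a derivation of
the instance into a derivation of the open formula. *)
Lemma nd_all_fresh k G A :
  (forall B, In B G -> form_below k B) -> form_below (S k) A ->
  nd G (subst_form (inst (Var k)) A) -> nd G (All A).
Proof.
  intros HG HA H. apply nd_all_intro.
  apply nd_subst with (s := fun i => if i =? k then Var 0 else Var (S i)) in H.
  rewrite subst_form_comp in H.
  rewrite (subst_form_below (S k)) with (s' := Var) in H; auto.
  - rewrite subst_form_var in H.
    rewrite (map_ext_in _ (subst_form shift)) in H; auto.
    intros B HB; apply (subst_form_below k); auto.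
    intros i Hi; destruct (Nat.eqb_spec i k); [lia|reflexivity].
  - intros [|i] Hi; cbn; [now rewrite Nat.eqb_refl|].
    destruct (Nat.eqb_spec i k); [lia|reflexivity].
Qed.

Definition bot : form := Neg (Eqn Zero Zero).

Lemma nd_explode G A B : nd G A -> nd G (Neg A) -> nd G B.
Proof.
  intros H H'; apply nd_raa with (B := A); (eapply nd_weak; [eassumption|apply incl_tl, incl_refl]).
Qed.

Lemma nd_neg_bot G A : nd (A :: G) bot -> nd G (Neg A).
Proof. intros H; eapply nd_neg_intro; [apply nd_eq_refl|exact H]. Qed.

Lemma nd_raa_bot G A : nd (Neg A :: G) bot -> nd G A.
Proof. intros H; eapply nd_raa; [apply nd_eq_refl|exact H]. Qed.

(** * Structures and satisfaction *)

Record structure := {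
  dom : Type;
  i_zero : dom;
  i_un : un_sym -> dom -> dom;
  i_bin : bin_sym -> dom -> dom -> dom;
  i_sub : dom -> dom -> dom -> dom;
  i_tr : dom -> Prop }.

Fixpoint eval (M : structure) (r : nat -> dom M) (t : term) : dom M :=
  match t with
  | Var i => r i
  | Zero => i_zero M
  | Un f a => i_un M f (eval M r a)
  | Bin f a b => i_bin M f (eval M r a) (eval M r b)
  | Sub a b c => i_sub M (eval M r a) (eval M r b) (eval M r c)
  end.

Fixpoint sat (M : structure) (r : nat -> dom M) (A : form) : Prop :=
  match A with
  | Eqn a b => eval M r a = eval M r b
  | Tr a => i_tr M (eval M r a)
  | Neg A => ~ sat M r A
  | Conj A B => sat M r A /\ sat M r B
  | All A => forall x, sat M (scons x r) A
  end.

Definition models (M : structure) (Th : theory) : Prop :=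
  forall A, Th A -> forall r, sat M r A.

Lemma eval_subst M r s t : eval M r (subst_term s t) = eval M (fun i => eval M r (s i)) t.
Proof. induction t; cbn; congruence. Qed.

Lemma sat_subst M s A :
  forall r, sat M r (subst_form s A) <-> sat M (fun i => eval M r (s i)) A.
Proof.
  revert s; induction A; cbn; intros s r; rewrite ?eval_subst; try tauto.
  - now rewrite IHA.
  - now rewrite IHA1, IHA2.
  - split; intros H x; specialize (H x); rewrite IHA in *;
      (replace (scons x (fun i => eval M r (s i)))
        with (fun i => eval M (scons x r) (up s i)) in *; [exact H|]);
      (extensionality i; destruct i as [|i]; cbn; auto; rewrite eval_subst; reflexivity).
Qed.

Lemma sat_inst M r t A :
  sat M r (subst_form (inst t) A) <-> sat M (scons (eval M r t) r) A.
Proof.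
  rewrite sat_subst.
  replace (fun i => eval M r (inst t i)) with (scons (eval M r t) r); [tauto|].
  extensionality i; now destruct i.
Qed.

Lemma soundness G A :
  nd G A -> forall M r, (forall B, In B G -> sat M r B) -> sat M r A.
Proof.
  induction 1; intros M r HG; cbn in *.
  - auto.
  - intro HA; apply (IHnd2 M r); [|apply IHnd1]; intros C [<-|HC]; auto.
  - apply NNPP; intro HA; apply (IHnd2 M r); [|apply IHnd1]; intros C [<-|HC]; auto.
  - split; auto.
  - now apply IHnd.
  - now apply IHnd.
  - intro x; apply IHnd; intros B HB.
    apply in_map_iff in HB as (C & <- & HC). apply sat_subst; auto.
  - apply sat_inst, IHnd; auto.
  - reflexivity.
  - apply sat_inst. rewrite <- (IHnd1 M r); auto. apply sat_inst, IHnd2; auto.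
Qed.

(** * Completeness *)

Definition code_un (f : un_sym) : nat :=
  match f with
  | sS => 0 | sNum => 1 | sTdot => 2 | sNeg => 3 | sAll => 4 | sTm => 5 | sFm => 6
  end.
Definition code_bin (f : bin_sym) : nat :=
  match f with
  | sAdd => 0 | sMul => 1 | sPair => 2 | sEqn => 3 | sConj => 4 | sOcc => 5 | sNth => 6
  end.

Fixpoint code_term (t : term) : nat :=
  match t with
  | Var i => to_nat (0, i)
  | Zero => to_nat (1, 0)
  | Un f a => to_nat (2, to_nat (code_un f, code_term a))
  | Bin f a b => to_nat (3, to_nat (code_bin f, to_nat (code_term a, code_term b)))
  | Sub a b c => to_nat (4, to_nat (code_term a, to_nat (code_term b, code_term c)))
  end.

Fixpoint code_form (A : form) : nat :=
  match A with
  | Eqn a b => to_nat (0, to_nat (code_term a, code_term b))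
  | Tr a => to_nat (1, code_term a)
  | Neg A => to_nat (2, code_form A)
  | Conj A B => to_nat (3, to_nat (code_form A, code_form B))
  | All A => to_nat (4, code_form A)
  end.

#[local] Opaque to_nat.

Ltac code_inj := repeat match goal with
  | H : to_nat _ = to_nat _ |- _ => apply to_nat_inj in H
  | H : (_, _) = (_, _) |- _ => injection H as; subst
  end.

Lemma code_term_inj t : forall t', code_term t = code_term t' -> t = t'.
Proof.
  induction t; intros [] H; cbn [code_term] in H; code_inj; try discriminate;
    f_equal; auto; repeat match goal with f : un_sym |- _ => destruct f
    | f : bin_sym |- _ => destruct f end; try discriminate; reflexivity.
Qed.

Lemma code_form_inj A : forall B, code_form A = code_form B -> A = B.
Proof.
  induction A; intros [] H; cbn [code_form] in H; code_inj; try discriminate;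
    f_equal; auto using code_term_inj.
Qed.

Definition enum (n : nat) : form := epsilon (inhabits bot) (fun A => code_form A = n).

Lemma enum_code A : enum (code_form A) = A.
Proof.
  apply code_form_inj. unfold enum. apply epsilon_spec. now exists A.
Qed.

Section Henkin.

Context (Th : theory) (closed : forall A, Th A -> sentence A).

Definition extends (L G : list form) : Prop := forall B, In B G -> Th B \/ In B L.
Definition consistent (L : list form) : Prop := forall G, extends L G -> ~ nd G bot.

Definition fresh (L : list form) : nat :=
  epsilon (inhabits 0) (fun n => forall A, In A L -> form_below n A).

Lemma fresh_spec L A : In A L -> form_below (fresh L) A.
Proof.
  revert A. apply (epsilon_spec (inhabits 0) (fun n => forall A, In A L -> form_below n A)).
  apply list_below_ex.
Qed.

(** One step of the construction of a maximal consistent set with witnesses: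
the formula [A] is added if that is consistent; otherwise, if [A] is universal,
a counterexample is added whose witness is a new variable.  Since the axioms
are sentences, every variable outside the finite list [L] is new. *)
Definition step (L : list form) (A : form) : list form :=
  if excluded_middle_informative (consistent (A :: L)) then A :: L
  else match A with
       | All B => Neg (subst_form (inst (Var (fresh (A :: L)))) B) :: L
       | _ => L
       end.

Lemma extends_cons A L G :
  extends (A :: L) G -> exists G', extends L G' /\ incl G (A :: G').
Proof.
  intros H. exists (filter (fun B =>
    if excluded_middle_informative (B = A) then false else true) G).
  split.
  - intros B HB; apply filter_In in HB as [HB E].
    destruct (excluded_middle_informative (B = A)); [discriminate|].
    destruct (H B HB) as [|[|]]; auto; congruence.
  - intros B HB. destruct (excluded_middle_informative (B = A)) as [->|N]; [now left|right].
    apply filter_In; split; auto. now destruct (excluded_middle_informative (B = A)).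
Qed.

Lemma inconsistent_neg A L : ~ consistent (A :: L) -> exists G, extends L G /\ nd G (Neg A).
Proof.
  intros H. apply not_all_ex_not in H as [G H]. apply imply_to_and in H as [H1 H2].
  apply NNPP in H2. apply extends_cons in H1 as (G' & HG & I).
  exists G'; split; auto. apply nd_neg_bot. eapply nd_weak; eauto.
Qed.

Lemma extends_app L G G' : extends L G -> extends L G' -> extends L (G ++ G').
Proof. intros H H' B HB; apply in_app_or in HB as []; auto. Qed.

Lemma step_consistent L A : consistent L -> consistent (step L A).
Proof.
  intros C. unfold step. destruct (excluded_middle_informative _) as [|N]; auto.
  destruct A as [| | | |A]; auto.
  apply NNPP; intro N'. apply inconsistent_neg in N as (G1 & E1 & H1), N' as (G2 & E2 & H2).
  set (k := fresh (All A :: L)) in *.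
  apply (C (G1 ++ G2)); [now apply extends_app|].
  apply nd_explode with (A := All A); [|eapply nd_weak; [exact H1|apply incl_appl, incl_refl]].
  eapply nd_weak; [|apply incl_appr, incl_refl].
  apply nd_all_fresh with (k := k).
  - intros B HB. destruct (E2 B HB) as [HT|HL].
    + eapply form_below_mono; [|apply (closed _ HT)]; lia.
    + apply fresh_spec; now right.
  - assert (form_below k (All A)) as K by (apply fresh_spec; now left). exact K.
  - apply nd_raa with (B := Neg (subst_form (inst (Var k)) A)).
    + apply nd_hyp; now left.
    + eapply nd_weak; [exact H2|apply incl_tl, incl_refl].
Qed.

Context (L0 : list form) (C0 : consistent L0).

Fixpoint stage (n : nat) : list form :=
  match n with 0 => L0 | S m => step (stage m) (enum m) end.

Lemma stage_S A : stage (S (code_form A)) = step (stage (code_form A)) A.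
Proof. cbn [stage]. now rewrite enum_code. Qed.

Lemma stage_consistent n : consistent (stage n).
Proof. induction n; cbn; auto using step_consistent. Qed.

Lemma stage_mono n m : n <= m -> incl (stage n) (stage m).
Proof.
  induction 1 as [|m _ IH]; [apply incl_refl|]. cbn. eapply incl_tran; [exact IH|].
  unfold step. destruct (excluded_middle_informative _); [apply incl_tl, incl_refl|].
  destruct (enum m); try apply incl_refl; apply incl_tl, incl_refl.
Qed.

Definition limit (A : form) : Prop := Th A \/ exists n, In A (stage n).

Lemma limit_finite G : (forall B, In B G -> limit B) -> exists n, extends (stage n) G.
Proof.
  induction G as [|A G IH]; intros H.
  - exists 0; intros B [].
  - destruct IH as [n Hn]; [intros; apply H; now right|].
    destruct (H A (or_introl eq_refl)) as [HA|[m Hm]].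
    + exists n; intros B [<-|HB]; auto.
    + exists (n + m); intros B [<-|HB].
      * right; eapply stage_mono; [|exact Hm]; lia.
      * destruct (Hn B HB); auto. right; eapply stage_mono; [|eassumption]; lia.
Qed.

(** Maximality, in the form in which it is used: [A] was added or refuted when its
turn came. *)
Lemma limit_or_refuted A : limit A \/ exists G, (forall B, In B G -> limit B) /\ nd G (Neg A).
Proof.
  destruct (classic (consistent (A :: stage (code_form A)))) as [C|C].
  - left; right; exists (S (code_form A)). rewrite stage_S; unfold step.
    destruct (excluded_middle_informative _); [now left|contradiction].
  - right. apply inconsistent_neg in C as (G & HG & H). exists G; split; auto.
    intros B HB; destruct (HG B HB); [now left|right; eauto].
Qed.

Lemma limit_closed G A : (forall B, In B G -> limit B) -> nd G A -> limit A.
Proof.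
  intros HG H. destruct (limit_or_refuted A) as [|(G' & HG' & H')]; auto. exfalso.
  destruct (limit_finite (G ++ G')) as [n Hn].
  { intros B HB; apply in_app_or in HB as []; auto. }
  apply (stage_consistent n _ Hn). apply nd_explode with (A := A).
  - eapply nd_weak; [exact H|apply incl_appl, incl_refl].
  - eapply nd_weak; [exact H'|apply incl_appr, incl_refl].
Qed.

Lemma limit_neg A : limit (Neg A) <-> ~ limit A.
Proof.
  split.
  - intros H H'. destruct (limit_finite [A; Neg A]) as [n Hn].
    { intros B [<-|[<-|[]]]; auto. }
    apply (stage_consistent n _ Hn), nd_explode with (A := A); apply nd_hyp; cbn; auto.
  - intros H. destruct (limit_or_refuted A) as [|(G & HG & H')]; [contradiction|].
    eapply limit_closed; eauto.
Qed.

Lemma limit_conj A B : limit (Conj A B) <-> limit A /\ limit B.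
Proof.
  split.
  - intros H; split.
    + apply (limit_closed [Conj A B]); [intros C [<-|[]]; auto|].
      eapply nd_conj_elim_l, nd_hyp; now left.
    + apply (limit_closed [Conj A B]); [intros C [<-|[]]; auto|].
      eapply nd_conj_elim_r, nd_hyp; now left.
  - intros [HA HB]. apply (limit_closed [A; B]); [intros C [<-|[<-|[]]]; auto|].
    apply nd_conj_intro; apply nd_hyp; cbn; auto.
Qed.

Lemma limit_all A : limit (All A) <-> forall t, limit (subst_form (inst t) A).
Proof.
  split.
  - intros H t. apply (limit_closed [All A]); [intros C [<-|[]]; auto|].
    apply nd_all_elim, nd_hyp; now left.
  - intros H. set (n := code_form (All A)).
    destruct (classic (consistent (All A :: stage n))) as [C|C].
    + right; exists (S (code_form (All A))); rewrite stage_S; unfold step; fold n.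
      destruct (excluded_middle_informative _); [now left|contradiction].
    + exfalso. apply (limit_neg (subst_form (inst (Var (fresh (All A :: stage n)))) A)); auto.
      right; exists (S (code_form (All A))); rewrite stage_S; unfold step; fold n.
      destruct (excluded_middle_informative _); [contradiction|now left].
Qed.

Lemma limit_eq_refl t : limit (Eqn t t).
Proof. apply (limit_closed []); [intros B []|apply nd_eq_refl]. Qed.

Lemma limit_rewrite A s t :
  limit (Eqn s t) -> limit (subst_form (inst s) A) -> limit (subst_form (inst t) A).
Proof.
  intros E H. apply (limit_closed [Eqn s t; subst_form (inst s) A]).
  { intros C [<-|[<-|[]]]; auto. }
  eapply nd_eq_subst; apply nd_hyp; cbn; auto.
Qed.

Lemma limit_eq_sym s t : limit (Eqn s t) -> limit (Eqn t s).
Proof.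
  intros E. assert (K := limit_rewrite (Eqn (Var 0) (subst_term shift s)) s t E).
  cbn in K. rewrite !subst_term_comp in K. cbn in K. rewrite !subst_term_var in K.
  apply K, limit_eq_refl.
Qed.

Lemma limit_eq_trans s t u : limit (Eqn s t) -> limit (Eqn t u) -> limit (Eqn s u).
Proof.
  intros E E'. assert (K := limit_rewrite (Eqn (subst_term shift s) (Var 0)) t u E').
  cbn in K. rewrite !subst_term_comp in K. cbn in K. rewrite !subst_term_var in K. auto.
Qed.

(** The elements of the term model are canonical representatives of the classes
of provably equal terms, so that equality in the model is Leibniz equality. *)
Definition rep (t : term) : term := epsilon (inhabits Zero) (fun s => limit (Eqn t s)).

Lemma rep_spec t : limit (Eqn t (rep t)).
Proof.
  apply (epsilon_spec (inhabits Zero) (fun s => limit (Eqn t s))). exists t; apply limit_eq_refl.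
Qed.

Lemma rep_eq s t : rep s = rep t <-> limit (Eqn s t).
Proof.
  split; intros H.
  - eapply limit_eq_trans; [apply rep_spec|]. rewrite H. apply limit_eq_sym, rep_spec.
  - unfold rep; f_equal. extensionality u. apply propositional_extensionality.
    split; intros H'; eapply limit_eq_trans; eauto using limit_eq_sym.
Qed.

Definition class : Type := { t : term | rep t = t }.
Definition cls (t : term) : class :=
  exist _ (rep t) (proj2 (rep_eq (rep t) t) (limit_eq_sym _ _ (rep_spec t))).

Lemma cls_eq s t : cls s = cls t <-> limit (Eqn s t).
Proof.
  rewrite <- rep_eq. split; intros H.
  - exact (f_equal (@proj1_sig _ _) H).
  - apply eq_sig_hprop; [intros; apply proof_irrelevance|exact H].
Qed.

Lemma cls_proj m : cls (proj1_sig m) = m.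
Proof. destruct m as [t H]. apply eq_sig_hprop; [intros; apply proof_irrelevance|exact H]. Qed.

Definition term_model : structure := {|
  dom := class;
  i_zero := cls Zero;
  i_un f a := cls (Un f (proj1_sig a));
  i_bin f a b := cls (Bin f (proj1_sig a) (proj1_sig b));
  i_sub a b c := cls (Sub (proj1_sig a) (proj1_sig b) (proj1_sig c));
  i_tr a := limit (Tr (proj1_sig a)) |}.

(** The context [C] has its hole at variable 0. *)
Lemma limit_eq_context (C : term) t u :
  limit (Eqn t u) -> limit (Eqn (subst_term (inst t) C) (subst_term (inst u) C)).
Proof.
  intros E.
  assert (K := limit_rewrite
    (Eqn (subst_term shift (subst_term (inst t) C)) C) t u E).
  cbn in K. rewrite !subst_term_comp in K. cbn in K. rewrite <- !subst_term_comp in K.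
  rewrite !subst_term_var in K. apply K, limit_eq_refl.
Qed.

Lemma eval_term_model r t :
  eval term_model r t = cls (subst_term (fun i => proj1_sig (r i)) t).
Proof.
  set (s := fun i => proj1_sig (r i)).
  assert (forall u, limit (Eqn (rep u) u)) as R by (intro; apply limit_eq_sym, rep_spec).
  assert (forall a b : term, subst_term (inst a) (subst_term shift b) = b) as Q.
  { intros; rewrite subst_term_comp; apply subst_term_var. }
  induction t as [i| |f a IHa|f a IHa b IHb|a IHa b IHb c IHc]; cbn; rewrite ?IHa, ?IHb, ?IHc; cbn.
  - symmetry; apply cls_proj.
  - reflexivity.
  - apply cls_eq. apply (limit_eq_context (Un f (Var 0))), R.
  - apply cls_eq.
    set (a' := subst_term s a); set (b' := subst_term s b).
    eapply limit_eq_trans.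
    + assert (K := limit_eq_context (Bin f (Var 0) (subst_term shift (rep b'))) _ _ (R a')).
      cbn in K; rewrite !Q in K; exact K.
    + assert (K := limit_eq_context (Bin f (subst_term shift a') (Var 0)) _ _ (R b')).
      cbn in K; rewrite !Q in K; exact K.
  - apply cls_eq.
    set (a' := subst_term s a); set (b' := subst_term s b); set (c' := subst_term s c).
    eapply limit_eq_trans; [|eapply limit_eq_trans].
    + assert (K := limit_eq_context
        (Sub (Var 0) (subst_term shift (rep b')) (subst_term shift (rep c'))) _ _ (R a')).
      cbn in K; rewrite !Q in K; exact K.
    + assert (K := limit_eq_context
        (Sub (subst_term shift a') (Var 0) (subst_term shift (rep c'))) _ _ (R b')).
      cbn in K; rewrite !Q in K; exact K.
    + assert (K := limit_eq_context
        (Sub (subst_term shift a') (subst_term shift b') (Var 0)) _ _ (R c')).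
      cbn in K; rewrite !Q in K; exact K.
Qed.

(** Truth in the term model is membership in [limit]; for universal formulas this
is where the witnesses of [limit_all] are used. *)
Lemma sat_term_model A : forall r,
  sat term_model r A <-> limit (subst_form (fun i => proj1_sig (r i)) A).
Proof.
  induction A; intros r; cbn [sat subst_form].
  - rewrite !eval_term_model. apply cls_eq.
  - rewrite eval_term_model; cbn. set (u := subst_term _ a).
    split; intros H.
    + apply (limit_rewrite (Tr (Var 0)) (rep u) u); auto. apply limit_eq_sym, rep_spec.
    + apply (limit_rewrite (Tr (Var 0)) u (rep u)); auto. apply rep_spec.
  - rewrite limit_neg, IHA; tauto.
  - rewrite limit_conj, IHA1, IHA2; tauto.
  - rewrite limit_all. split.
    + intros H t. rewrite subst_inst_up.
      specialize (H (cls t)). apply IHA in H.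
      rewrite <- subst_inst_up. apply (limit_rewrite _ (rep t) t); [apply limit_eq_sym, rep_spec|].
      rewrite subst_inst_up. erewrite f_equal2; [exact H| |reflexivity].
      extensionality i; now destruct i.
    + intros H m. apply IHA. specialize (H (proj1_sig m)). rewrite subst_inst_up in H.
      erewrite f_equal2; [exact H| |reflexivity].
      extensionality i; now destruct i.
Qed.

End Henkin.

Theorem completeness Th A : (forall B, Th B -> sentence B) -> sentence A ->
  (forall M, models M Th -> forall r, sat M r A) -> proves Th A.
Proof.
  intros closed HA H. apply NNPP; intros N.
  assert (consistent Th [Neg A]) as C.
  { intros G HG B. apply N. apply extends_cons in HG as (G' & HG' & I).
    exists G'; split.
    - intros X HX; destruct (HG' X HX) as [|[]]; auto.
    - apply nd_raa_bot. eapply nd_weak; eauto. }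
  assert (forall s B, sentence B -> subst_form s B = B) as Q.
  { intros s B HB. rewrite (subst_form_below 0) with (s' := Var); auto.
    - apply subst_form_var.
    - intros i Hi; lia. }
  set (r := fun i => cls Th closed [Neg A] C (Var i)).
  assert (limit Th [Neg A] A) as L.
  { assert (models (term_model Th closed [Neg A] C) Th) as HM.
    { intros B HB r'. apply sat_term_model. rewrite Q; auto. now left. }
    assert (L := proj1 (sat_term_model Th closed _ C A r) (H _ HM r)).
    rewrite Q in L; auto. }
  apply limit_neg in L; auto. right; exists 0; now left.
Qed.
(** * Semantic reading of formulas *)

Section Semantics.

Context (M : structure).
Implicit Types (r : nat -> dom M) (A B : form) (P Q : Prop).

Lemma sat_neg_iff r A P : (sat M r A <-> P) -> (sat M r (Neg A) <-> ~ P).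
Proof. cbn; tauto. Qed.
Lemma sat_conj_iff r A B P Q :
  (sat M r A <-> P) -> (sat M r B <-> Q) -> (sat M r (Conj A B) <-> P /\ Q).
Proof. cbn; tauto. Qed.
Lemma sat_or_iff r A B P Q :
  (sat M r A <-> P) -> (sat M r B <-> Q) -> (sat M r (Or A B) <-> P \/ Q).
Proof. cbn; intros; destruct (classic P); tauto. Qed.
Lemma sat_imp_iff r A B P Q :
  (sat M r A <-> P) -> (sat M r B <-> Q) -> (sat M r (Imp A B) <-> (P -> Q)).
Proof. cbn; intros; destruct (classic Q); tauto. Qed.
Lemma sat_iff_iff r A B P Q :
  (sat M r A <-> P) -> (sat M r B <-> Q) -> (sat M r (Iff A B) <-> (P <-> Q)).
Proof. cbn; intros; destruct (classic P), (classic Q); tauto. Qed.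
Lemma sat_all_iff r A (P : dom M -> Prop) :
  (forall x, sat M (scons x r) A <-> P x) -> (sat M r (All A) <-> forall x, P x).
Proof. cbn; intros H; split; intros K x; apply H, K. Qed.
Lemma sat_ex_iff r A (P : dom M -> Prop) :
  (forall x, sat M (scons x r) A <-> P x) -> (sat M r (Ex A) <-> exists x, P x).
Proof.
  cbn; intros H; split.
  - intros K. apply NNPP; intros N; apply K; intros x Hx; apply N; exists x; now apply H.
  - intros [x Hx] K; apply (K x); now apply H.
Qed.
Lemma sat_disj_un_iff r (A : un_sym -> lform) (B : lform) d (P : un_sym -> Prop) Q :
  (forall f, sat M r (A f d) <-> P f) -> (sat M r (B d) <-> Q) ->
  (sat M r (disj_un A B d) <-> (exists f, P f) \/ Q).
Proof.
  intros HA HB. assert (forall l, sat M r (fold_right (fun f C => lOr (A f) C) B l d)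
    <-> (exists f, In f l /\ P f) \/ Q) as K.
  { induction l as [|f l IH]; cbn [fold_right].
    - rewrite HB; firstorder.
    - unfold lOr. rewrite (sat_or_iff _ _ _ _ _ (HA f) IH). cbn; firstorder congruence. }
  unfold disj_un. rewrite K. assert (forall f, In f all_un) by (intros []; cbn; tauto).
  split; (intros [(f & Hf)|H']; [left; exists f; intuition|auto]).
Qed.
Lemma sat_disj_bin_iff r (A : bin_sym -> lform) (B : lform) d (P : bin_sym -> Prop) Q :
  (forall f, sat M r (A f d) <-> P f) -> (sat M r (B d) <-> Q) ->
  (sat M r (disj_bin A B d) <-> (exists f, P f) \/ Q).
Proof.
  intros HA HB. assert (forall l, sat M r (fold_right (fun f C => lOr (A f) C) B l d)
    <-> (exists f, In f l /\ P f) \/ Q) as K.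
  { induction l as [|f l IH]; cbn [fold_right].
    - rewrite HB; firstorder.
    - unfold lOr. rewrite (sat_or_iff _ _ _ _ _ (HA f) IH). cbn; firstorder congruence. }
  unfold disj_bin. rewrite K. assert (forall f, In f all_bin) by (intros []; cbn; tauto).
  split; (intros [(f & Hf)|H']; [left; exists f; intuition|auto]).
Qed.
Lemma sat_ex_un_iff r (A : un_sym -> form) B (P : un_sym -> Prop) Q :
  (forall f, sat M r (A f) <-> P f) -> (sat M r B <-> Q) ->
  (sat M r (disj_un (fun f _ => A f) (fun _ => B) 0) <-> (exists f, P f) \/ Q).
Proof. intros; now apply sat_disj_un_iff. Qed.
Lemma sat_ex_bin_iff r (A : bin_sym -> form) B (P : bin_sym -> Prop) Q :
  (forall f, sat M r (A f) <-> P f) -> (sat M r B <-> Q) ->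
  (sat M r (disj_bin (fun f _ => A f) (fun _ => B) 0) <-> (exists f, P f) \/ Q).
Proof. intros; now apply sat_disj_bin_iff. Qed.
Lemma sat_eqn_iff r a b x y :
  eval M r a = x -> eval M r b = y -> (sat M r (Eqn a b) <-> x = y).
Proof. now intros <- <-. Qed.
Lemma sat_tr_iff r a x : eval M r a = x -> (sat M r (Tr a) <-> i_tr M x).
Proof. now intros <-. Qed.
Lemma eval_un r f a x : eval M r a = x -> eval M r (Un f a) = i_un M f x.
Proof. now intros <-. Qed.
Lemma eval_bin r f a b x y :
  eval M r a = x -> eval M r b = y -> eval M r (Bin f a b) = i_bin M f x y.
Proof. now intros <- <-. Qed.
Lemma eval_sub r a b c x y z :
  eval M r a = x -> eval M r b = y -> eval M r c = z ->
  eval M r (Sub a b c) = i_sub M x y z.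
Proof. now intros <- <- <-. Qed.
Lemma eval_zero r : eval M r Zero = i_zero M.
Proof. reflexivity. Qed.
Lemma eval_var r i : eval M r (Var i) = r i.
Proof. reflexivity. Qed.

Fixpoint nm (n : nat) : dom M :=
  match n with 0 => i_zero M | S m => i_un M sS (nm m) end.

Lemma eval_numeral r n : eval M r (numeral n) = nm n.
Proof. induction n; cbn; congruence. Qed.

Definition pair (a b : dom M) := i_bin M sPair a b.
Definition kVar (i : dom M) := pair (nm tag_var) i.
Definition kZero := pair (nm tag_zero) (i_zero M).
Definition kUn (f : un_sym) (a : dom M) := pair (nm (tag_un f)) a.
Definition kBin (f : bin_sym) (a b : dom M) := pair (nm (tag_bin f)) (pair a b).
Definition kSub (a b c : dom M) := pair (nm tag_sub) (pair a (pair b c)).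
Definition kEqn (a b : dom M) := pair (nm tag_eqn) (pair a b).
Definition kTr (a : dom M) := pair (nm tag_tr) a.
Definition kNeg (x : dom M) := pair (nm tag_neg) x.
Definition kConj (x y : dom M) := pair (nm tag_conj) (pair x y).
Definition kAll (x : dom M) := pair (nm tag_all) x.

(** Counterparts in [M] of [quote_term] and [quote_form].  The free variables are
replaced by closed terms [s 0], [s 1], ... that may differ: descending under a
quantifier adds the term that instantiates it. *)
Fixpoint qterm (s : nat -> dom M) (k : nat) (t : term) : dom M :=
  match t with
  | Var i => if i <? k then kVar (nm i) else s (i - k)
  | Zero => kZero
  | Un f a => kUn f (qterm s k a)
  | Bin f a b => kBin f (qterm s k a) (qterm s k b)
  | Sub a b c => kSub (qterm s k a) (qterm s k b) (qterm s k c)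
  end.

Fixpoint qform (s : nat -> dom M) (k : nat) (A : form) : dom M :=
  match A with
  | Eqn a b => kEqn (qterm s k a) (qterm s k b)
  | Tr a => kTr (qterm s k a)
  | Neg A => kNeg (qform s k A)
  | Conj A B => kConj (qform s k A) (qform s k B)
  | All A => kAll (qform s (S k) A)
  end.

Lemma eval_quote_term r c k t d :
  eval M r (quote_term c k t d) = qterm (fun _ => eval M r (c d)) k t.
Proof.
  induction t as [i| | | |]; cbn -[numeral nm Nat.ltb]; unfold lnum; rewrite ?eval_numeral;
    try (unfold kZero, kUn, kBin, kSub, pair; congruence).
  destruct (i <? k); [|reflexivity]. cbn -[numeral nm]. unfold lnum. now rewrite !eval_numeral.
Qed.

Lemma eval_quote r c k A d x : eval M r (c d) = x ->
  eval M r (quote_form c k A d) = qform (fun _ => x) k A.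
Proof.
  intros <-. revert k; induction A; intros k; cbn -[numeral nm];
    unfold lnum; rewrite ?eval_numeral, ?eval_quote_term, ?IHA, ?IHA1, ?IHA2; reflexivity.
Qed.

(** The predicates to which induction in [M] is applied.  They are closed: parameters
are generalized within the induction formula. *)
Definition definable (P : dom M -> Prop) : Prop :=
  exists A, forall r, sat M r A <-> P (r 0).

End Semantics.

(* Tries the variables in turn; the statements below nest at most fifteen binders. *)
Ltac sem_var := first
  [ exact (eval_var _ _ 0) | exact (eval_var _ _ 1) | exact (eval_var _ _ 2)
  | exact (eval_var _ _ 3) | exact (eval_var _ _ 4) | exact (eval_var _ _ 5)
  | exact (eval_var _ _ 6) | exact (eval_var _ _ 7) | exact (eval_var _ _ 8)
  | exact (eval_var _ _ 9) | exact (eval_var _ _ 10) | exact (eval_var _ _ 11)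
  | exact (eval_var _ _ 12) | exact (eval_var _ _ 13) | exact (eval_var _ _ 14) ].

Ltac sem_term := lazymatch goal with
  | |- eval _ _ _ = i_un _ _ _ => apply eval_un; sem_term
  | |- eval _ _ _ = i_bin _ _ _ _ => apply eval_bin; sem_term
  | |- eval _ _ _ = i_sub _ _ _ _ => apply eval_sub; sem_term
  | |- eval _ _ _ = qform _ _ _ _ => apply eval_quote; sem_term
  | |- eval _ _ _ = i_zero _ => apply eval_zero
  | |- eval _ _ _ = nm _ _ => apply eval_numeral
  | |- eval _ _ ?t = _ => tryif is_evar t then sem_var else reflexivity
  end.

(** Proves that a formula holds in the structure iff the proposition on the right
does, by descending along the connectives of the proposition.  If the formula is an
existential variable it is constructed on the way. *)
Ltac sem := cbv beta; lazymatch goal with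
  | |- _ <-> (_ <-> _) => apply sat_iff_iff; sem
  | |- _ <-> (_ /\ _) => apply sat_conj_iff; sem
  | |- sat _ _ ?A <-> (@ex un_sym _ \/ _) =>
      (tryif is_evar A then apply sat_ex_un_iff else apply sat_disj_un_iff); [intro; sem|sem]
  | |- sat _ _ ?A <-> (@ex bin_sym _ \/ _) =>
      (tryif is_evar A then apply sat_ex_bin_iff else apply sat_disj_bin_iff); [intro; sem|sem]
  | |- _ <-> (_ \/ _) => apply sat_or_iff; sem
  | |- _ <-> (~ _) => apply sat_neg_iff; sem
  | |- _ <-> (ex _) => apply sat_ex_iff; intro; sem
  | |- _ <-> (_ = _) => apply sat_eqn_iff; sem_term
  | |- _ <-> (i_tr _ _) => apply sat_tr_iff; sem_term
  | |- _ <-> (?P -> _) => lazymatch type of P with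
       | Prop => apply sat_imp_iff; sem
       | _ => apply sat_all_iff; intro; sem
       end
  | |- _ <-> (forall x, _) => apply sat_all_iff; intro; sem
  end.

Create HintDb sem.
#[local] Hint Unfold pair kVar kZero kUn kBin kSub kEqn kTr kNeg kConj kAll : sem.

(** [H] says that the structure is a model of a theory that has the axiom [h]. *)
Ltac by_axiom H h := refine (proj1 (_ : sat _ (fun _ => i_zero _) _ <-> _) (H _ h _));
  autounfold with sem; sem.

Ltac definability := autounfold with sem; eexists; intro; sem.

(** * Arithmetic in a model of PA *)

(** The formulas quoted in T12 and T13. *)
Definition all_instances_true : form :=
  open1 (fun c => allTerm (fun t => T (sub c lZero t))).
Definition some_instance_false : form :=
  open1 (fun c => exTerm (fun t => F (sub c lZero t))).

Declare Scope model_scope.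

Section Model.

Context (M : structure) (HPA : models M PA).

Notation "0" := (i_zero M) : model_scope.
Notation "1" := (nm M 1) : model_scope.
Notation "x + y" := (i_bin M sAdd x y) : model_scope.
Notation "x * y" := (i_bin M sMul x y) : model_scope.
Notation nS x := (i_un M sS x).
Notation num x := (i_un M sNum x).
Notation pair := (pair M).
Notation kVar := (kVar M).
Notation kZero := (kZero M).
Notation kUn := (kUn M).
Notation kBin := (kBin M).
Notation kSub := (kSub M).
Notation kEqn := (kEqn M).
Notation kTr := (kTr M).
Notation kNeg := (kNeg M).
Notation kConj := (kConj M).
Notation kAll := (kAll M).
Notation qterm := (qterm M).
Notation qform := (qform M).
Open Scope model_scope.

Lemma S_zero : forall x, nS x <> 0.
Proof. by_axiom HPA pa_S_zero. Qed.
Lemma S_inj : forall x y, nS x = nS y -> x = y.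
Proof. by_axiom HPA pa_S_inj. Qed.
Lemma add_zero : forall x, x + 0 = x.
Proof. by_axiom HPA pa_add_zero. Qed.
Lemma add_S : forall x y, x + nS y = nS (x + y).
Proof. by_axiom HPA pa_add_S. Qed.
Lemma mul_zero : forall x, x * 0 = 0.
Proof. by_axiom HPA pa_mul_zero. Qed.
Lemma mul_S : forall x y, x * nS y = x * y + x.
Proof. by_axiom HPA pa_mul_S. Qed.

Lemma sat_alls n A : (forall r, sat M r (alls n A)) -> forall r, sat M r A.
Proof.
  induction n as [|n IH]; cbn [alls]; auto.
  intros H. apply IH. intros r. specialize (H (fun i => r (S i)) (r O)).
  replace r with (scons (r O) (fun i => r (S i))); auto.
  extensionality i; now destruct i.
Qed.

Lemma alls_below n A : forall k, form_below (n + k) A -> form_below k (alls n A).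
Proof.
  induction n as [|n IH]; cbn; auto. intros k H. apply IH. now rewrite Nat.add_succ_r.
Qed.

Lemma induction (P : dom M -> Prop) : definable M P ->
  P 0 -> (forall x, P x -> P (nS x)) -> forall x, P x.
Proof.
  intros [A HA] H0 HS.
  destruct (form_below_ex (ind_instance A)) as [n Hn].
  assert (forall r, sat M r (ind_instance A)) as K.
  { apply (sat_alls n). apply HPA, pa_ind, alls_below. now rewrite Nat.add_0_r. }
  specialize (K (fun _ => 0)). refine (proj1 (_ : sat M (fun _ => 0) (ind_instance A) <-> _) K _).
  - unfold ind_instance.
    apply (sat_imp_iff _ _ _ _ (P 0 /\ forall x, P x -> P (nS x)) (forall x, P x)).
    + apply sat_conj_iff; [rewrite sat_inst; apply HA|].
      apply sat_all_iff; intro x. apply sat_imp_iff; [apply HA|].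
      rewrite sat_subst; apply HA.
    + apply sat_all_iff; intro x; apply HA.
  - auto.
Qed.

Ltac ind x := pattern x; revert x; apply induction; [definability| |].

Lemma zero_or_S x : x = 0 \/ exists y, x = nS y.
Proof. ind x; eauto. Qed.

Lemma zero_add x : 0 + x = x.
Proof. ind x; intros; rewrite ?add_zero, ?add_S; congruence. Qed.

Lemma S_add x y : nS x + y = nS (x + y).
Proof.
  revert x; ind y; intros; rewrite ?add_zero, ?add_S; congruence.
Qed.

Lemma add_comm x y : x + y = y + x.
Proof.
  revert x; ind y; intros; rewrite ?add_zero, ?zero_add, ?add_S, ?S_add; congruence.
Qed.

Lemma add_assoc x y z : x + (y + z) = x + y + z.
Proof. revert x y; ind z; intros; rewrite ?add_zero, ?add_S; congruence. Qed.

Lemma zero_mul x : 0 * x = 0.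
Proof. ind x; intros; rewrite ?mul_zero, ?mul_S, ?add_zero; congruence. Qed.

Lemma S_mul x y : nS x * y = x * y + y.
Proof.
  revert x; ind y; intros; rewrite ?mul_zero, ?mul_S, ?add_zero; auto.
  rewrite H, !add_S; f_equal. rewrite <- !add_assoc; f_equal; apply add_comm.
Qed.

Lemma mul_comm x y : x * y = y * x.
Proof.
  revert x; ind y; intros; rewrite ?mul_zero, ?zero_mul, ?mul_S, ?S_mul; congruence.
Qed.

Lemma mul_add x y z : x * (y + z) = x * y + x * z.
Proof.
  revert x y; ind z; intros; rewrite ?add_zero, ?add_S, ?mul_zero, ?mul_S, ?add_zero; auto.
  now rewrite H, add_assoc.
Qed.

Lemma mul_assoc x y z : x * (y * z) = x * y * z.
Proof.
  revert x y; ind z; intros; rewrite ?mul_zero, ?mul_S; auto.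
  now rewrite mul_add, H.
Qed.

Lemma one_mul x : 1 * x = x.
Proof. cbn. now rewrite S_mul, zero_mul, zero_add. Qed.

Lemma M_semi_ring : semi_ring_theory 0 1 (i_bin M sAdd) (i_bin M sMul) eq.
Proof.
  split; intros.
  - apply zero_add.
  - apply add_comm.
  - apply add_assoc.
  - apply one_mul.
  - apply zero_mul.
  - apply mul_comm.
  - apply mul_assoc.
  - rewrite !(mul_comm _ p); apply mul_add.
Qed.

Add Ring M_ring : M_semi_ring.

Lemma S_one x : nS x = x + 1.
Proof. cbn. now rewrite add_S, add_zero. Qed.

Lemma add_cancel x y z : x + z = y + z -> x = y.
Proof.
  revert x y; ind z.
  - intros x y. now rewrite !add_zero.
  - intros n IH x y. rewrite !add_S. intros H. apply IH, S_inj, H.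
Qed.

Lemma add_eq_zero x y : x + y = 0 -> x = 0 /\ y = 0.
Proof.
  destruct (zero_or_S y) as [->|[z ->]]; rewrite ?add_zero, ?add_S; auto.
  intros H; now apply S_zero in H.
Qed.

Lemma mul_eq_one x y : x * y = 1 -> x = 1 /\ y = 1.
Proof.
  destruct (zero_or_S x) as [->|[a ->]]; rewrite ?zero_mul.
  { intros H; symmetry in H; now apply S_zero in H. }
  destruct (zero_or_S y) as [->|[b ->]]; rewrite ?mul_zero.
  { intros H; symmetry in H; now apply S_zero in H. }
  rewrite S_mul, add_S. intros H. apply S_inj, add_eq_zero in H as [H ->].
  rewrite mul_S in H. apply add_eq_zero in H as [_ ->]; auto.
Qed.

Definition lt (x y : dom M) : Prop := exists z, y = nS (x + z).
Hint Unfold lt : sem.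

Lemma nm_inj i j : nm M i = nm M j -> i = j.
Proof.
  revert j; induction i as [|i IH]; intros [|j] H; cbn in H; auto.
  - symmetry in H; now apply S_zero in H.
  - now apply S_zero in H.
  - f_equal; apply IH, S_inj, H.
Qed.

Lemma lt_or_eq_or_gt x y : lt x y \/ x = y \/ lt y x.
Proof.
  unfold lt. revert x; ind y; intros.
  - destruct (zero_or_S x) as [->|[z ->]]; auto.
    right; right; exists z. now rewrite zero_add.
  - destruct (H x0) as [[z ->]|[->|[z ->]]].
    + left; exists (nS z). now rewrite add_S.
    + left; exists 0. now rewrite add_zero.
    + destruct (zero_or_S z) as [->|[w ->]].
      * right; left. now rewrite add_zero.
      * right; right; exists w. now rewrite S_add, add_S.
Qed.

Lemma lt_S x y : lt x (nS y) -> lt x y \/ x = y.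
Proof.
  intros [z Hz]. apply S_inj in Hz as ->. destruct (zero_or_S z) as [->|[w ->]].
  - right; now rewrite add_zero.
  - left; exists w. apply add_S.
Qed.

Lemma strong_induction (P : dom M -> Prop) : definable M P ->
  (forall x, (forall y, lt y x -> P y) -> P x) -> forall x, P x.
Proof.
  intros [A HA] H. enough (forall x y, lt y x -> P y) as K.
  { intros x; apply H, K. }
  intros x; pattern x; revert x; apply induction.
  - unfold lt. eexists (All (Imp (Ex (Eqn (Var 2) (Un sS (Bin sAdd (Var 1) (Var 0))))) _)). intro r.
    cbv beta; apply sat_all_iff; intro y. apply sat_imp_iff; [sem|apply HA].
  - intros y [z Hz]. symmetry in Hz; now apply S_zero in Hz.
  - intros x IH y Hy. apply lt_S in Hy as [ | -> ]; auto.
Qed.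

(** * Pairing *)

Lemma pair_def : forall a b, pair a b = (a + b) * (a + b) + a.
Proof. by_axiom HPA pa_pair. Qed.

(** Squares of distinct numbers n < m differ by more than n, so [(a + b)^2 + a]
determines [a + b]. *)
Lemma square_gap n m a c : lt n m -> lt a (nS n) -> n * n + a <> m * m + c.
Proof.
  intros [k ->] [l Hl] E. apply S_inj in Hl as ->.
  apply (S_zero (a + l + l + (a + l) * k + (a + l) * k + k + k + k * k + c)).
  apply (add_cancel _ _ ((a + l) * (a + l) + a)). rewrite zero_add. etransitivity; [|symmetry; exact E].
  rewrite !S_one; ring.
Qed.

Lemma pair_inj a b c d : pair a b = pair c d -> a = c /\ b = d.
Proof.
  rewrite !pair_def. intros E.
  destruct (lt_or_eq_or_gt (a + b) (c + d)) as [L|[H|L]].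
  - apply square_gap in E as []; auto. now exists b.
  - rewrite H in E. rewrite !(add_comm (_ * _)) in E. apply add_cancel in E as ->.
    split; auto. rewrite !(add_comm c) in H. now apply add_cancel in H.
  - symmetry in E; apply square_gap in E as []; auto. now exists d.
Qed.

Lemma square_ge x : exists y, x * x = x + y.
Proof.
  destruct (zero_or_S x) as [->|[z ->]].
  - exists 0; ring.
  - exists (z * z + z). rewrite S_one; ring.
Qed.

(** Tags are positive, so by the next three lemmas an expression has a larger code
than its parts, and strong induction on codes is induction on syntax. *)
Lemma lt_pair t a : lt a (pair (nS t) a).
Proof.
  rewrite pair_def. destruct (square_ge (nS t + a)) as [y ->].
  exists (t + y + nS t). rewrite !S_one; ring.
Qed.

Lemma lt_pair_l x a b : lt (pair a b) x -> lt a x.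
Proof.
  rewrite pair_def. intros [z ->]. exists ((a + b) * (a + b) + z). f_equal; ring.
Qed.

Lemma lt_pair_r x a b : lt (pair a b) x -> lt b x.
Proof.
  rewrite pair_def. destruct (square_ge (a + b)) as [y ->].
  intros [z ->]. exists (a + y + a + z). f_equal; ring.
Qed.

(** * Codes of terms and formulas *)

Notation isTm x := (i_un M sTm x).
Notation isFm x := (i_un M sFm x).
Notation occs v x := (i_bin M sOcc v x).
Notation subs x v t := (i_sub M x v t).
Notation proj s i := (i_bin M sNth s i).
Notation dotT x := (i_un M sTdot x).
Notation dotNeg x := (i_un M sNeg x).
Notation dotAll x := (i_un M sAll x).
Notation dotEqn x y := (i_bin M sEqn x y).
Notation dotConj x y := (i_bin M sConj x y).

Definition termShape (x : dom M) : Prop :=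
  (exists f a, x = kUn f a) \/ (exists f a b, x = kBin f a b)
  \/ (exists i, x = kVar i) \/ x = kZero \/ (exists a b c, x = kSub a b c).
Definition formShape (x : dom M) : Prop :=
  (exists a b, x = kEqn a b) \/ (exists a, x = kTr a) \/ (exists y, x = kNeg y)
  \/ (exists y z, x = kConj y z) \/ (exists y, x = kAll y).
Definition clTerm (x : dom M) : Prop := isTm x = 1 /\ forall v, occs v x = 0.
Definition sent (x : dom M) : Prop := isFm x = 1 /\ forall v, occs v x = 0.
Definition form1 (v x : dom M) : Prop := isFm x = 1 /\ forall w, occs w x <> 0 -> w = v.
Hint Unfold termShape formShape clTerm sent form1 : sem.

Ltac axiom h := by_axiom HPA h.

Lemma num_zero : num 0 = kZero.
Proof. axiom pa_num_zero. Qed.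
Lemma num_S : forall x, num (nS x) = kUn sS (num x).
Proof. axiom pa_num_S. Qed.
Lemma eqn_def : forall s t, dotEqn s t = kEqn s t.
Proof. axiom pa_eqn. Qed.
Lemma tdot_def : forall t, dotT t = kTr t.
Proof. axiom pa_tdot. Qed.
Lemma conj_def : forall x y, dotConj x y = kConj x y.
Proof. axiom pa_conj. Qed.
Lemma all_def : forall x, dotAll x = kAll x.
Proof. axiom pa_all. Qed.
Lemma neg_def : forall x, sent x -> dotNeg x = kNeg x.
Proof. axiom pa_neg. Qed.
Lemma neg_default : forall x, ~ sent x -> dotNeg x = kEqn kZero kZero.
Proof. axiom pa_neg_default. Qed.

Lemma tm_var : forall i, isTm (kVar i) = 1.
Proof. axiom pa_tm_var. Qed.
Lemma tm_zero : isTm kZero = 1.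
Proof. axiom pa_tm_zero. Qed.
Lemma tm_un f : forall a, isTm (kUn f a) = isTm a.
Proof. axiom (pa_tm_un f). Qed.
Lemma tm_bin f : forall a b, isTm (kBin f a b) = isTm a * isTm b.
Proof. axiom (pa_tm_bin f). Qed.
Lemma tm_sub : forall a b c, isTm (kSub a b c) = isTm a * isTm b * isTm c.
Proof. axiom pa_tm_sub. Qed.
Lemma tm_default : forall x, ~ termShape x -> isTm x = 0.
Proof. axiom pa_tm_default. Qed.
Lemma fm_eqn : forall a b, isFm (kEqn a b) = isTm a * isTm b.
Proof. axiom pa_fm_eqn. Qed.
Lemma fm_tr : forall a, isFm (kTr a) = isTm a.
Proof. axiom pa_fm_tr. Qed.
Lemma fm_neg : forall x, isFm (kNeg x) = isFm x.
Proof. axiom pa_fm_neg. Qed.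
Lemma fm_conj : forall x y, isFm (kConj x y) = isFm x * isFm y.
Proof. axiom pa_fm_conj. Qed.
Lemma fm_all : forall x, isFm (kAll x) = isFm x.
Proof. axiom pa_fm_all. Qed.
Lemma fm_default : forall x, ~ formShape x -> isFm x = 0.
Proof. axiom pa_fm_default. Qed.

Lemma occ_var_same : forall v, occs v (kVar v) = 1.
Proof. axiom pa_occ_var_same. Qed.
Lemma occ_var_other : forall v i, i <> v -> occs v (kVar i) = 0.
Proof. axiom pa_occ_var_other. Qed.
Lemma occ_zero : forall v, occs v kZero = 0.
Proof. axiom pa_occ_zero. Qed.
Lemma occ_un f : forall v a, occs v (kUn f a) = occs v a.
Proof. axiom (pa_occ_un f). Qed.
Lemma occ_bin f : forall v a b, occs v (kBin f a b) = occs v a + occs v b.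
Proof. axiom (pa_occ_bin f). Qed.
Lemma occ_sub : forall v a b c, occs v (kSub a b c) = occs v a + occs v b + occs v c.
Proof. axiom pa_occ_sub. Qed.
Lemma occ_eqn : forall v a b, occs v (kEqn a b) = occs v a + occs v b.
Proof. axiom pa_occ_eqn. Qed.
Lemma occ_tr : forall v a, occs v (kTr a) = occs v a.
Proof. axiom pa_occ_tr. Qed.
Lemma occ_neg : forall v x, occs v (kNeg x) = occs v x.
Proof. axiom pa_occ_neg. Qed.
Lemma occ_conj : forall v x y, occs v (kConj x y) = occs v x + occs v y.
Proof. axiom pa_occ_conj. Qed.
Lemma occ_all : forall v x, occs v (kAll x) = occs (nS v) x.
Proof. axiom pa_occ_all. Qed.
Lemma occ_default : forall v x, ~ (termShape x \/ formShape x) -> occs v x = 0.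
Proof. axiom pa_occ_default. Qed.

Lemma sub_var_same : forall v t, subs (kVar v) v t = t.
Proof. axiom pa_sub_var_same. Qed.
Lemma sub_var_other : forall v t i, i <> v -> subs (kVar i) v t = kVar i.
Proof. axiom pa_sub_var_other. Qed.
Lemma sub_zero : forall v t, subs kZero v t = kZero.
Proof. axiom pa_sub_zero. Qed.
Lemma sub_un f : forall v t a, subs (kUn f a) v t = kUn f (subs a v t).
Proof. axiom (pa_sub_un f). Qed.
Lemma sub_bin f : forall v t a b,
  subs (kBin f a b) v t = kBin f (subs a v t) (subs b v t).
Proof. axiom (pa_sub_bin f). Qed.
Lemma sub_sub : forall v t a b c,
  subs (kSub a b c) v t = kSub (subs a v t) (subs b v t) (subs c v t).
Proof. axiom pa_sub_sub. Qed.
Lemma sub_eqn : forall v t a b, subs (kEqn a b) v t = kEqn (subs a v t) (subs b v t).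
Proof. axiom pa_sub_eqn. Qed.
Lemma sub_tr : forall v t a, subs (kTr a) v t = kTr (subs a v t).
Proof. axiom pa_sub_tr. Qed.
Lemma sub_neg : forall v t x, subs (kNeg x) v t = kNeg (subs x v t).
Proof. axiom pa_sub_neg. Qed.
Lemma sub_conj : forall v t x y, subs (kConj x y) v t = kConj (subs x v t) (subs y v t).
Proof. axiom pa_sub_conj. Qed.
Lemma sub_all : forall v t x, subs (kAll x) v t = kAll (subs x (nS v) t).
Proof. axiom pa_sub_all. Qed.
Lemma sub_default : forall v t x, ~ (termShape x \/ formShape x) -> subs x v t = x.
Proof. axiom pa_sub_default. Qed.

Lemma nth_head : forall a r, proj (nS (pair a r)) 0 = a.
Proof. axiom pa_nth_head. Qed.
Lemma nth_tail : forall a r i, proj (nS (pair a r)) (nS i) = proj r i.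
Proof. axiom pa_nth_tail. Qed.
Lemma nth_default : forall s i, ~ (exists a r, s = nS (pair a r)) -> proj s i = 0.
Proof. axiom pa_nth_default. Qed.

Ltac syn := repeat first
  [ rewrite tm_var | rewrite tm_zero | rewrite tm_un | rewrite tm_bin | rewrite tm_sub
  | rewrite fm_eqn | rewrite fm_tr | rewrite fm_neg | rewrite fm_conj | rewrite fm_all
  | rewrite occ_var_same | rewrite occ_zero | rewrite occ_un | rewrite occ_bin
  | rewrite occ_sub | rewrite occ_eqn | rewrite occ_tr | rewrite occ_neg
  | rewrite occ_conj | rewrite occ_all
  | rewrite sub_var_same | rewrite sub_zero | rewrite sub_un | rewrite sub_bin
  | rewrite sub_sub | rewrite sub_eqn | rewrite sub_tr | rewrite sub_neg
  | rewrite sub_conj | rewrite sub_all | rewrite one_mul | rewrite add_zero ].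
Ltac syn_in H := repeat first
  [ rewrite tm_var in H | rewrite tm_zero in H | rewrite tm_un in H
  | rewrite tm_bin in H | rewrite tm_sub in H
  | rewrite fm_eqn in H | rewrite fm_tr in H | rewrite fm_neg in H
  | rewrite fm_conj in H | rewrite fm_all in H
  | rewrite occ_var_same in H | rewrite occ_zero in H | rewrite occ_un in H
  | rewrite occ_bin in H | rewrite occ_sub in H | rewrite occ_eqn in H
  | rewrite occ_tr in H | rewrite occ_neg in H | rewrite occ_conj in H
  | rewrite occ_all in H ].

Lemma tag_un_pos f : exists m, nm M (tag_un f) = nS m.
Proof. destruct f; eexists; reflexivity. Qed.
Lemma tag_bin_pos f : exists m, nm M (tag_bin f) = nS m.
Proof. destruct f; eexists; reflexivity. Qed.

Ltac lt_code := first
  [ apply lt_pair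
  | eapply lt_pair_l, lt_pair | eapply lt_pair_r, lt_pair
  | eapply lt_pair_l, lt_pair_r, lt_pair | eapply lt_pair_r, lt_pair_r, lt_pair ].

Lemma lt_kUn f a : lt a (kUn f a).
Proof. unfold kUn. destruct (tag_un_pos f) as [m ->]. lt_code. Qed.
Lemma lt_kBin f a b : lt a (kBin f a b) /\ lt b (kBin f a b).
Proof. unfold kBin. destruct (tag_bin_pos f) as [m ->]. split; lt_code. Qed.
Lemma lt_kSub a b c : lt a (kSub a b c) /\ lt b (kSub a b c) /\ lt c (kSub a b c).
Proof. unfold kSub. cbn [nm tag_sub]. repeat split; lt_code. Qed.
Lemma lt_kEqn a b : lt a (kEqn a b) /\ lt b (kEqn a b).
Proof. unfold kEqn. cbn [nm tag_eqn]. split; lt_code. Qed.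
Lemma lt_kTr a : lt a (kTr a).
Proof. unfold kTr. cbn [nm tag_tr]. lt_code. Qed.
Lemma lt_kNeg a : lt a (kNeg a).
Proof. unfold kNeg. cbn [nm tag_neg]. lt_code. Qed.
Lemma lt_kConj a b : lt a (kConj a b) /\ lt b (kConj a b).
Proof. unfold kConj. cbn [nm tag_conj]. split; lt_code. Qed.
Lemma lt_kAll a : lt a (kAll a).
Proof. unfold kAll. cbn [nm tag_all]. lt_code. Qed.

(** Numbers that code no expression are covered by the last premise: the functions on
codes have default values there, so the identities below hold for all numbers. *)
Lemma code_induction (P : dom M -> Prop) : definable M P ->
  (forall i, P (kVar i)) -> P kZero ->
  (forall f a, P a -> P (kUn f a)) ->
  (forall f a b, P a -> P b -> P (kBin f a b)) ->
  (forall a b c, P a -> P b -> P c -> P (kSub a b c)) ->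
  (forall a b, P a -> P b -> P (kEqn a b)) ->
  (forall a, P a -> P (kTr a)) ->
  (forall x, P x -> P (kNeg x)) ->
  (forall x y, P x -> P y -> P (kConj x y)) ->
  (forall x, P x -> P (kAll x)) ->
  (forall x, ~ (termShape x \/ formShape x) -> P x) ->
  forall x, P x.
Proof.
  intros HP Hvar Hzero Hun Hbin Hsub Heqn Htr Hneg Hconj Hall Hdef.
  apply strong_induction; auto. intros x IH.
  destruct (classic (termShape x \/ formShape x)) as [[H|H]|H]; auto.
  - destruct H as [(f&a&->)|[(f&a&b&->)|[(i&->)|[->|(a&b&c&->)]]]]; auto.
    + apply Hun, IH, lt_kUn.
    + apply Hbin; apply IH, lt_kBin.
    + apply Hsub; apply IH, lt_kSub.
  - destruct H as [(a&b&->)|[(a&->)|[(y&->)|[(y&z&->)|(y&->)]]]]; auto.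
    + apply Heqn; apply IH, lt_kEqn.
    + apply Htr, IH, lt_kTr.
    + apply Hneg, IH, lt_kNeg.
    + apply Hconj; apply IH, lt_kConj.
    + apply Hall, IH, lt_kAll.
Qed.

Lemma zero_one : 0 <> 1.
Proof. intros H; symmetry in H; now apply S_zero in H. Qed.

Lemma tm_induction (P : dom M -> Prop) : definable M P ->
  (forall i, P (kVar i)) -> P kZero ->
  (forall f a, isTm a = 1 -> P a -> P (kUn f a)) ->
  (forall f a b, isTm a = 1 -> isTm b = 1 -> P a -> P b -> P (kBin f a b)) ->
  (forall a b c, isTm a = 1 -> isTm b = 1 -> isTm c = 1 ->
    P a -> P b -> P c -> P (kSub a b c)) ->
  forall x, isTm x = 1 -> P x.
Proof.
  intros [A HA] Hvar Hzero Hun Hbin Hsub.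
  intros x; pattern x; revert x; apply strong_induction.
  { exists (Imp (Eqn (Un sTm (Var 0)) (numeral 1)) A). intros r.
    apply sat_imp_iff; [sem|apply HA]. }
  intros x IH Hx.
  destruct (classic (termShape x)) as [H|H].
  2: { rewrite tm_default in Hx; auto. now apply zero_one in Hx. }
  destruct H as [(f&a&->)|[(f&a&b&->)|[(i&->)|[->|(a&b&c&->)]]]]; auto; syn_in Hx.
  - auto using lt_kUn.
  - apply mul_eq_one in Hx as []. apply Hbin; auto; apply IH; auto; apply lt_kBin.
  - apply mul_eq_one in Hx as [[]%mul_eq_one ?].
    apply Hsub; auto; apply IH; auto; apply lt_kSub.
Qed.

Lemma fm_induction (P : dom M -> Prop) : definable M P ->
  (forall a b, isTm a = 1 -> isTm b = 1 -> P (kEqn a b)) ->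
  (forall a, isTm a = 1 -> P (kTr a)) ->
  (forall x, isFm x = 1 -> P x -> P (kNeg x)) ->
  (forall x y, isFm x = 1 -> isFm y = 1 -> P x -> P y -> P (kConj x y)) ->
  (forall x, isFm x = 1 -> P x -> P (kAll x)) ->
  forall x, isFm x = 1 -> P x.
Proof.
  intros [A HA] Heqn Htr Hneg Hconj Hall.
  intros x; pattern x; revert x; apply strong_induction.
  { exists (Imp (Eqn (Un sFm (Var 0)) (numeral 1)) A). intros r.
    apply sat_imp_iff; [sem|apply HA]. }
  intros x IH Hx.
  destruct (classic (formShape x)) as [H|H].
  2: { rewrite fm_default in Hx; auto. now apply zero_one in Hx. }
  destruct H as [(a&b&->)|[(a&->)|[(y&->)|[(y&z&->)|(y&->)]]]]; syn_in Hx; auto.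
  - apply mul_eq_one in Hx as []; auto.
  - auto using lt_kNeg.
  - apply mul_eq_one in Hx as []. apply Hconj; auto; apply IH; auto; apply lt_kConj.
  - auto using lt_kAll.
Qed.

Ltac on_codes x := pattern x; revert x; apply code_induction; [definability| ..].
Ltac on_tm x := let H := fresh in intros H; pattern x; revert H; revert x;
  apply tm_induction; [definability| ..].
Ltac on_fm x := let H := fresh in intros H; pattern x; revert H; revert x;
  apply fm_induction; [definability| ..].

Ltac split_occ := repeat match goal with
  | H : _ + _ = 0 |- _ => apply add_eq_zero in H as [? ?]
  end.

Lemma sub_not_occ x : forall v t, occs v x = 0 -> subs x v t = x.
Proof.
  on_codes x; intros; try match goal with H : occs _ _ = 0 |- _ => syn_in H end;
    split_occ; syn; try (f_equal; auto; fail).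
  - apply sub_var_other; intros ->. rewrite occ_var_same in H. now apply S_zero in H.
  - now apply sub_default.
Qed.

Lemma occ_sub_same x : forall v t, (forall w, occs w t = 0) -> occs v (subs x v t) = 0.
Proof.
  on_codes x; intros; syn;
    repeat match goal with IH : forall v t, _ -> occs v (subs _ v t) = 0 |- _ =>
      rewrite IH by assumption end; rewrite ?add_zero; auto.
  - destruct (classic (i = v)) as [->|N]; [now rewrite sub_var_same|].
    rewrite sub_var_other; auto. now apply occ_var_other.
  - now rewrite sub_default, occ_default.
Qed.

Lemma occ_sub_other x : forall v w t, (forall u, occs u t = 0) -> w <> v ->
  occs w (subs x v t) = occs w x.
Proof.
  on_codes x; intros; syn;
    repeat match goal with IH : forall v w t, _ -> _ -> occs w (subs _ v t) = _ |- _ =>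
      rewrite IH by (assumption || (intros K; apply S_inj in K; auto)) end; auto.
  - destruct (classic (i = v)) as [->|N]; [|now rewrite sub_var_other].
    rewrite sub_var_same, occ_var_other; auto.
  - now rewrite sub_default.
Qed.

Lemma tm_subst x : isTm x = 1 -> forall v t, isTm t = 1 -> isTm (subs x v t) = 1.
Proof.
  on_tm x; intros; syn;
    repeat match goal with IH : forall v t, _ -> isTm (subs _ v t) = 1 |- _ =>
      rewrite IH by assumption end; rewrite ?one_mul; auto.
  destruct (classic (i = v)) as [->|N]; [now rewrite sub_var_same|].
  rewrite sub_var_other; auto using tm_var.
Qed.

Lemma fm_subst x : isFm x = 1 -> forall v t, isTm t = 1 -> isFm (subs x v t) = 1.
Proof.
  on_fm x; intros; syn; rewrite ?tm_subst by assumption;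
    repeat match goal with IH : forall v t, _ -> isFm (subs _ v t) = 1 |- _ =>
      rewrite IH by assumption end; rewrite ?one_mul; auto.
Qed.

(** A quantifier is instantiated after the free variable below it has been replaced;
the swap makes an instance of the body out of this. *)
Lemma sub_swap x : forall v w s t, v <> w ->
  (forall u, occs u s = 0) -> (forall u, occs u t = 0) ->
  subs (subs x v s) w t = subs (subs x w t) v s.
Proof.
  on_codes x; intros; syn; try (f_equal; auto; fail).
  - destruct (classic (i = v)) as [->|N].
    + rewrite sub_var_same, (sub_var_other w), sub_var_same by auto. now apply sub_not_occ.
    + rewrite (sub_var_other v) by auto. destruct (classic (i = w)) as [->|N'].
      * rewrite sub_var_same. now rewrite sub_not_occ.
      * now rewrite (sub_var_other w), (sub_var_other v) by auto.
  - f_equal. apply H; auto. intros K; apply S_inj in K; auto.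
  - now rewrite !(sub_default _ _ x).
Qed.

(** * Finite sequences and relations defined by clauses *)

Definition entry (s t y : dom M) : Prop := exists i, proj s i = nS (pair t y).
Hint Unfold entry : sem.

Lemma entry_zero t y : ~ entry 0 t y.
Proof.
  intros [i H]. rewrite nth_default in H; [symmetry in H; now apply S_zero in H|].
  intros (a & r & E). symmetry in E; now apply S_zero in E.
Qed.

Lemma entry_cons a r t y : entry (nS (pair a r)) t y <-> a = nS (pair t y) \/ entry r t y.
Proof.
  split.
  - intros [i H]. destruct (zero_or_S i) as [->|[j ->]].
    + left; now rewrite nth_head in H.
    + right; exists j; now rewrite nth_tail in H.
  - intros [->|[i H]]; [exists 0; apply nth_head|exists (nS i); now rewrite nth_tail].
Qed.

Lemma lt_nS x : lt x (nS x).
Proof. exists 0. now rewrite add_zero. Qed.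

Lemma entry_union s1 : forall s2, exists s, forall t y,
  entry s t y <-> entry s1 t y \/ entry s2 t y.
Proof.
  pattern s1; revert s1; apply strong_induction; [definability|]. intros s1 IH s2.
  destruct (classic (exists a r, s1 = nS (pair a r))) as [(a & r & ->)|N].
  - destruct (IH r) with s2 as [s Hs]; [eapply lt_pair_r, lt_nS|].
    exists (nS (pair a s)). intros t y. rewrite !entry_cons, Hs; tauto.
  - exists s2; intros t y; split; auto. intros [[i H]|]; auto.
    rewrite nth_default in H; auto. symmetry in H; now apply S_zero in H.
Qed.

(** A relation defined by recursion on codes is not available as a function symbol.
Instead it is generated by a monotone clause [Cl]: a pair belongs to it if it occurs
in a finite sequence each of whose entries satisfies the clause relative to the
sequence.  The lemmas say that it is a fixed point of the clause, as far as the
clause refers to finitely many pairs. *)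
Section Clauses.

Context (Cl : (dom M -> dom M -> Prop) -> dom M -> dom M -> Prop).
Context (Cl_mono : forall (R R' : dom M -> dom M -> Prop),
  (forall t y, R t y -> R' t y) -> forall t y, Cl R t y -> Cl R' t y).

Definition supported (s : dom M) : Prop := forall t y, entry s t y -> Cl (entry s) t y.
Definition generated (t y : dom M) : Prop := exists s, supported s /\ entry s t y.

Lemma generated_inv t y : generated t y -> Cl generated t y.
Proof.
  intros (s & Hs & H). eapply Cl_mono; [|apply Hs, H]. intros u z K; now exists s.
Qed.

Lemma supported_union s1 s2 : supported s1 -> supported s2 ->
  exists s, supported s /\ forall t y, entry s1 t y \/ entry s2 t y -> entry s t y.
Proof.
  intros H1 H2. destruct (entry_union s1 s2) as [s Hs]. exists s; split; [|apply Hs].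
  intros t y [K|K]%Hs; (eapply Cl_mono; [|apply H1, K || apply H2, K]);
    intros; apply Hs; auto.
Qed.

Lemma generated_intro s t y : supported s -> Cl (entry s) t y -> generated t y.
Proof.
  intros Hs H. exists (nS (pair (nS (pair t y)) s)); split.
  - intros u z K. apply Cl_mono with (R := entry s).
    + intros; apply entry_cons; auto.
    + apply entry_cons in K as [E|K]; auto.
      apply S_inj, pair_inj in E as [-> ->]; auto.
  - apply entry_cons; auto.
Qed.

Lemma generated_common t y u z : generated t y -> generated u z ->
  exists s, supported s /\ entry s t y /\ entry s u z.
Proof.
  intros (s1 & H1 & K1) (s2 & H2 & K2).
  destruct (supported_union s1 s2 H1 H2) as (s & Hs & Us). exists s; auto.
Qed.

End Clauses.
Hint Unfold supported generated : sem.

(** * Values of closed terms *)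

Definition evalClause (R : dom M -> dom M -> Prop) (t y : dom M) : Prop :=
  (exists f a x, t = kUn f a /\ y = i_un M f x /\ R a x)
  \/ (exists f a b x z, t = kBin f a b /\ y = i_bin M f x z /\ R a x /\ R b z)
  \/ (t = kZero /\ y = 0)
  \/ (exists a b c x z w, t = kSub a b c /\ y = i_sub M x z w /\ R a x /\ R b z /\ R c w).
Definition val (t y : dom M) : Prop := generated evalClause t y.
Hint Unfold evalClause val : sem.

Lemma evalClause_mono R R' : (forall t y, R t y -> R' t y) ->
  forall t y, evalClause R t y -> evalClause R' t y.
Proof.
  intros H t y [(f&a&x&K)|[(f&a&b&x&z&K)|[K|(a&b&c&x&z&w&K)]]];
    [left|right; left|right; right; left|right; right; right]; auto.
  - exists f, a, x; intuition.
  - exists f, a, b, x, z; intuition.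
  - exists a, b, c, x, z, w; intuition.
Qed.

Lemma val_zero : val kZero 0.
Proof.
  apply (generated_intro _ evalClause_mono 0).
  - intros t y H; now apply entry_zero in H.
  - right; right; now left.
Qed.

Lemma val_un f a x : val a x -> val (kUn f a) (i_un M f x).
Proof.
  intros (s & Hs & H). apply (generated_intro _ evalClause_mono s _ _ Hs).
  left; exists f, a, x; auto.
Qed.

Lemma val_bin f a b x y : val a x -> val b y -> val (kBin f a b) (i_bin M f x y).
Proof.
  intros Ha Hb. destruct (generated_common _ evalClause_mono _ _ _ _ Ha Hb) as (s & Hs & K & L).
  apply (generated_intro _ evalClause_mono s _ _ Hs).
  right; left; exists f, a, b, x, y; auto.
Qed.

Lemma val_sub a b c x y z : val a x -> val b y -> val c z -> val (kSub a b c) (i_sub M x y z).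
Proof.
  intros Ha Hb (s2 & H2 & K2).
  destruct (generated_common _ evalClause_mono _ _ _ _ Ha Hb) as (s1 & H1 & K & L).
  destruct (supported_union _ evalClause_mono s1 s2 H1 H2) as (s & Hs & Us).
  apply (generated_intro _ evalClause_mono s _ _ Hs).
  right; right; right; exists a, b, c, x, y, z; auto 10.
Qed.

(** The terms in question include those with nonstandard codes, hence the induction
inside the model. *)
Lemma val_total t : clTerm t -> exists y, val t y.
Proof.
  intros [H H']. revert H'. revert H. on_tm t.
  - intros i H. specialize (H i). rewrite occ_var_same in H. now apply S_zero in H.
  - intros _; exists 0; apply val_zero.
  - intros f a _ IH H. destruct IH as [x Hx].
    { intros v; specialize (H v). now syn_in H. }
    exists (i_un M f x); now apply val_un.
  - intros f a b _ _ IHa IHb H. destruct IHa as [x Hx], IHb as [y Hy];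
      try (intros v; specialize (H v); syn_in H; split_occ; auto; fail).
    exists (i_bin M f x y); now apply val_bin.
  - intros a b c _ _ _ IHa IHb IHc H. destruct IHa as [x Hx], IHb as [y Hy], IHc as [z Hz];
      try (intros v; specialize (H v); syn_in H; split_occ; auto; fail).
    exists (i_sub M x y z); now apply val_sub.
Qed.

Lemma num_val x : val (num x) x.
Proof.
  ind x.
  - rewrite num_zero; apply val_zero.
  - intros y H. rewrite num_S; now apply val_un.
Qed.

Lemma num_closed x : clTerm (num x).
Proof.
  ind x.
  - rewrite num_zero; split; intros; now syn.
  - intros y [H K]. rewrite num_S; split; intros; now syn.
Qed.

(** * Depth of formulas *)

(** [depth x n] says that [n] bounds the nesting of connectives in [x].  Unlike the
code of [x], such a bound is preserved by substitution ([depth_subst]). *)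
Definition depthClause (R : dom M -> dom M -> Prop) (x n : dom M) : Prop :=
  (exists a b, x = kEqn a b) \/ (exists a, x = kTr a)
  \/ (exists y m, x = kNeg y /\ lt m n /\ R y m)
  \/ (exists y z m k, x = kConj y z /\ lt m n /\ lt k n /\ R y m /\ R z k)
  \/ (exists y m, x = kAll y /\ lt m n /\ R y m).
Definition depth (x n : dom M) : Prop := generated depthClause x n.
Hint Unfold depthClause depth : sem.

Lemma depthClause_mono R R' : (forall t y, R t y -> R' t y) ->
  forall t y, depthClause R t y -> depthClause R' t y.
Proof.
  intros H t y [K|[K|[(z&m&K)|[(z&w&m&k&K)|(z&m&K)]]]];
    [left|right; left|right; right; left|right; right; right; left|right; right; right; right]; auto.
  - exists z, m; intuition.
  - exists z, w, m, k; intuition.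
  - exists z, m; intuition.
Qed.

Lemma depth_atom x n : (exists a b, x = kEqn a b) \/ (exists a, x = kTr a) -> depth x n.
Proof.
  intros H. apply (generated_intro _ depthClause_mono 0).
  - intros t y K; now apply entry_zero in K.
  - destruct H; [now left|right; now left].
Qed.

Lemma depth_neg x n m : depth x m -> lt m n -> depth (kNeg x) n.
Proof.
  intros (s & Hs & H) L. apply (generated_intro _ depthClause_mono s _ _ Hs).
  right; right; left; eauto.
Qed.

Lemma depth_all x n m : depth x m -> lt m n -> depth (kAll x) n.
Proof.
  intros (s & Hs & H) L. apply (generated_intro _ depthClause_mono s _ _ Hs).
  right; right; right; right; eauto.
Qed.

Lemma depth_conj x y n m k : depth x m -> depth y k -> lt m n -> lt k n -> depth (kConj x y) n.
Proof.
  intros Hx Hy L L'.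
  destruct (generated_common _ depthClause_mono _ _ _ _ Hx Hy) as (s & Hs & K & K').
  apply (generated_intro _ depthClause_mono s _ _ Hs).
  right; right; right; left; exists x, y, m, k; auto.
Qed.

Lemma depth_total x : isFm x = 1 -> depth x x.
Proof.
  on_fm x; intros.
  - apply depth_atom; eauto.
  - apply depth_atom; eauto.
  - eapply depth_neg; eauto using lt_kNeg.
  - eapply depth_conj; eauto; apply lt_kConj.
  - eapply depth_all; eauto using lt_kAll.
Qed.

Lemma depth_subst n : forall x v t, depth x n -> depth (subs x v t) n.
Proof.
  pattern n; revert n; apply strong_induction; [definability|]. intros n IH x v t H.
  apply (generated_inv _ depthClause_mono) in H.
  destruct H as [(a&b&->)|[(a&->)|[(y&m&->&L&K)|[(y&z&m&k&->&L&L'&K&K')|(y&m&->&L&K)]]]]; syn.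
  - apply depth_atom; eauto.
  - apply depth_atom; eauto.
  - eapply depth_neg; eauto; apply IH; auto.
  - eapply depth_conj; eauto; apply IH; auto.
  - eapply depth_all; eauto; apply IH; auto.
Qed.

(** * Well-formedness of codes *)

Lemma sent_neg x : sent x -> sent (kNeg x).
Proof. intros [H K]; split; intros; now syn. Qed.
Lemma sent_conj x y : sent x -> sent y -> sent (kConj x y).
Proof. intros [H K] [H' K']; split; intros; syn;
  now rewrite ?H, ?H', ?K, ?K', ?one_mul, ?add_zero. Qed.
Lemma sent_eqn s t : clTerm s -> clTerm t -> sent (kEqn s t).
Proof. intros [H K] [H' K']; split; intros; syn;
  now rewrite ?H, ?H', ?K, ?K', ?one_mul, ?add_zero. Qed.
Lemma sent_tr t : clTerm t -> sent (kTr t).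
Proof. intros [H K]; split; intros; now syn. Qed.
Lemma sent_neg_inv x : sent (kNeg x) -> sent x.
Proof. intros [H K]; syn_in H; split; auto. intros v; specialize (K v); now syn_in K. Qed.
Lemma sent_conj_inv x y : sent (kConj x y) -> sent x /\ sent y.
Proof.
  intros [H K]; syn_in H; apply mul_eq_one in H as [? ?].
  split; (split; auto); intros v; specialize (K v); syn_in K; split_occ; auto.
Qed.
Lemma sent_eqn_inv s t : sent (kEqn s t) -> clTerm s /\ clTerm t.
Proof.
  intros [H K]; syn_in H; apply mul_eq_one in H as [? ?].
  split; (split; auto); intros v; specialize (K v); syn_in K; split_occ; auto.
Qed.
Lemma sent_tr_inv t : sent (kTr t) -> clTerm t.
Proof. intros [H K]; syn_in H; split; auto. intros v; specialize (K v); now syn_in K. Qed.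
Lemma clTerm_un f t : clTerm t -> clTerm (kUn f t).
Proof. intros [H K]; split; intros; now syn. Qed.
Lemma sent_all x : form1 0 x -> sent (kAll x).
Proof.
  intros [H K]; split; intros; syn; auto.
  apply NNPP; intros N. now apply K, S_zero in N.
Qed.
Lemma sent_subst v x t : form1 v x -> clTerm t -> sent (subs x v t).
Proof.
  intros [H K] [H' K']; split; [now apply fm_subst|]. intros w.
  destruct (classic (w = v)) as [->|N]; [now apply occ_sub_same|].
  rewrite occ_sub_other; auto. apply NNPP; auto.
Qed.

Definition closes (s : nat -> dom M) : Prop := forall i, clTerm (s i).

Lemma closes_scons t s : clTerm t -> closes s -> closes (scons t s).
Proof. intros H K [|i]; cbn; auto. Qed.

Lemma qterm_tm s k t : closes s -> isTm (qterm s k t) = 1.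
Proof.
  intros H; induction t as [i| | | |]; cbn -[nm Nat.ltb]; syn; rewrite ?IHt, ?IHt1, ?IHt2, ?IHt3, ?one_mul; auto.
  destruct (i <? k); [apply tm_var|apply H].
Qed.

Lemma qform_fm s A : closes s -> forall k, isFm (qform s k A) = 1.
Proof.
  intros H; induction A; intros k; cbn -[nm Nat.ltb]; syn;
    rewrite ?IHA, ?IHA1, ?IHA2, ?qterm_tm, ?one_mul; auto.
Qed.

Lemma occ_qterm s k t v : closes s -> (forall i, i < k -> v <> nm M i)%nat ->
  occs v (qterm s k t) = 0.
Proof.
  intros H Hv; induction t as [i| | | |]; cbn -[nm Nat.ltb]; syn;
    rewrite ?IHt, ?IHt1, ?IHt2, ?IHt3, ?add_zero; auto.
  destruct (Nat.ltb_spec i k); [|apply H].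
  apply occ_var_other. intros E; now apply (Hv i).
Qed.

Lemma occ_qform s A : closes s -> forall k v, (forall i, i < k -> v <> nm M i)%nat ->
  occs v (qform s k A) = 0.
Proof.
  intros H; induction A; intros k v Hv; cbn -[nm Nat.ltb]; syn;
    rewrite ?occ_qterm, ?IHA, ?IHA1, ?IHA2, ?add_zero; auto.
  intros [|i] Hi E; cbn in E; [now apply S_zero in E|].
  apply S_inj in E. apply (Hv i); auto; lia.
Qed.

Lemma sent_qform s A : closes s -> sent (qform s O A).
Proof. intros H; split; [now apply qform_fm|]. intros v; apply occ_qform; auto; lia. Qed.

Lemma clTerm_qterm s t : closes s -> clTerm (qterm s O t).
Proof. intros H; split; [now apply qterm_tm|]. intros v; apply occ_qterm; auto; lia. Qed.

Lemma form1_qform s A : closes s -> form1 0 (qform s 1%nat A).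
Proof.
  intros H; split; [now apply qform_fm|]. intros v N. apply NNPP; intros N'. apply N.
  apply occ_qform; auto. intros [|i] Hi; auto; lia.
Qed.

Lemma sub_qterm s k t u : closes s -> subs (qterm s (S k) t) (nm M k) u = qterm (scons u s) k t.
Proof.
  intros H; induction t as [i| | | |]; cbn -[nm Nat.ltb]; syn; try congruence.
  destruct (Nat.ltb_spec i (S k)), (Nat.ltb_spec i k); try lia.
  - apply sub_var_other. intros E; apply nm_inj in E; lia.
  - replace i with k by lia. now rewrite sub_var_same, Nat.sub_diag.
  - rewrite sub_not_occ by apply H. now replace (i - k)%nat with (S (i - S k)) by lia.
Qed.

(** Instantiating the outermost of the [S k] bound variables, with index [k], amounts
to one more term in the environment. *)
Lemma sub_qform s A u : closes s ->
  forall k, subs (qform s (S k) A) (nm M k) u = qform (scons u s) k A.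
Proof.
  intros H; induction A; intros k; cbn -[nm Nat.ltb]; syn; rewrite ?sub_qterm; auto; try congruence.
  f_equal. apply (IHA (S k)).
Qed.

Lemma val_qterm s r t : (forall i, val (s i) (r i)) -> val (qterm s O t) (eval M r t).
Proof.
  intros H; induction t; cbn; auto using val_zero, val_un, val_bin, val_sub.
  now rewrite Nat.sub_0_r.
Qed.

(** * The axioms of truth and determinateness, read in the model *)

Notation tru x := (i_tr M x).

(** [TTtm] and [TFtm] take the code of a closed term, [TTof] and [TFof] a number, to
whose numeral they apply. *)
Definition TTtm (t : dom M) : Prop := tru (dotT t).
Definition TFtm (t : dom M) : Prop := tru (kTr (kUn sNeg t)).
Definition TTof (x : dom M) : Prop := TTtm (num x).
Definition TFof (x : dom M) : Prop := TFtm (num x).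
Definition det (x : dom M) : Prop := ~ TTof x \/ ~ TFof x.
Definition code_det (t : dom M) : dom M := qform (fun _ => t) O (open1 D).
Hint Unfold TTtm TFtm TTof TFof det code_det : sem.

Definition allVal (Q : dom M -> dom M -> Prop) : Prop :=
  forall t, clTerm t -> forall y, val t y -> Q t y.
Hint Unfold allVal : sem.

Definition T1_holds := allVal (fun s y => allVal (fun t z => tru (dotEqn s t) <-> y = z)).
Definition T2_holds := allVal (fun t y => det y <-> tru (code_det t)).
Definition T3_holds := allVal (fun t y => det y -> (TTtm t <-> tru y)).
Definition T4_holds := forall x, sent x -> (tru (dotNeg x) <-> ~ tru x).
Definition T5_holds := forall x, sent x -> forall y, sent y ->
  (tru (dotConj x y) <-> tru x /\ tru y).
Definition T6_holds := forall x, form1 0 x ->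
  (tru (dotAll x) <-> forall t, clTerm t -> tru (subs x 0 t)).
Definition D1_holds := forall s, clTerm s -> forall t, clTerm t -> det (dotEqn s t).
Definition D2_holds := allVal (fun t y => det (dotT t) <-> det y).
Definition D3_holds := allVal (fun t y => det (code_det t) <-> det y).
Definition D4_holds := forall x, sent x -> (det (dotNeg x) <-> det x).
Definition D5_holds := forall x, sent x -> forall y, sent y ->
  (det (dotConj x y) <-> (det x /\ det y) \/ (det x /\ tru (dotNeg x)) \/ (det y /\ tru (dotNeg y))).
Definition D6_holds := forall x, form1 0 x ->
  (det (dotAll x) <-> (forall t, clTerm t -> det (subs x 0 t))
     \/ (exists t, clTerm t /\ det (subs x 0 t) /\ tru (dotNeg (subs x 0 t)))).
Definition R1_holds := forall v x, form1 v x -> allVal (fun s y => allVal (fun t z =>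
  y = z -> (tru (subs x v s) <-> tru (subs x v t)))).
Definition R2_holds := forall v x, form1 v x -> allVal (fun s y => allVal (fun t z =>
  y = z -> (det (subs x v s) <-> det (subs x v t)))).
Definition T7_holds := allVal (fun s y => allVal (fun t z => TTof (dotEqn s t) <-> y = z)).
Definition T8_holds := allVal (fun s y => allVal (fun t z => TFof (dotEqn s t) <-> ~ y = z)).
Definition T9_holds := forall x, sent x -> (TTof x <-> TTof (dotNeg (dotNeg x))).
Definition T10_holds := forall x, sent x -> forall y, sent y ->
  (TTof (dotConj x y) <-> TTof x /\ TTof y).
Definition T11_holds := forall x, sent x -> forall y, sent y ->
  (TFof (dotConj x y) <-> TFof x \/ TFof y).
Definition T12_holds := forall x, form1 0 x ->
  (TTof (dotAll x) <-> tru (qform (fun _ => num x) O all_instances_true)).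
Definition T13_holds := forall x, form1 0 x ->
  (TFof (dotAll x) <-> tru (qform (fun _ => num x) O some_instance_false)).
Definition T14_holds := forall t, clTerm t -> (TTof (dotT t) <-> TTtm t).
Definition T15_holds := forall t, clTerm t -> (TFof (dotT t) <-> TFtm t).
Definition TRep_holds := allVal (fun t y => tru y -> TTtm t).

Ltac reading := autounfold with sem; sem.

Lemma sat_T1 r : sat M r T1 <-> T1_holds. Proof. unfold T1_holds; reading. Qed.
Lemma sat_T2 r : sat M r T2plus <-> T2_holds. Proof. unfold T2_holds; reading. Qed.
Lemma sat_T3 r : sat M r T3 <-> T3_holds. Proof. unfold T3_holds; reading. Qed.
Lemma sat_T4 r : sat M r T4 <-> T4_holds. Proof. unfold T4_holds; reading. Qed.
Lemma sat_T5 r : sat M r T5 <-> T5_holds. Proof. unfold T5_holds; reading. Qed.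
Lemma sat_T6 r : sat M r T6 <-> T6_holds. Proof. unfold T6_holds; reading. Qed.
Lemma sat_D1 r : sat M r D1 <-> D1_holds. Proof. unfold D1_holds; reading. Qed.
Lemma sat_D2 r : sat M r D2 <-> D2_holds. Proof. unfold D2_holds; reading. Qed.
Lemma sat_D3 r : sat M r D3 <-> D3_holds. Proof. unfold D3_holds; reading. Qed.
Lemma sat_D4 r : sat M r D4 <-> D4_holds. Proof. unfold D4_holds; reading. Qed.
Lemma sat_D5 r : sat M r D5 <-> D5_holds. Proof. unfold D5_holds; reading. Qed.
Lemma sat_D6 r : sat M r D6 <-> D6_holds. Proof. unfold D6_holds; reading. Qed.
Lemma sat_R1 r : sat M r R1 <-> R1_holds. Proof. unfold R1_holds; reading. Qed.
Lemma sat_R2 r : sat M r R2 <-> R2_holds. Proof. unfold R2_holds; reading. Qed.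
Lemma sat_T7 r : sat M r T7 <-> T7_holds. Proof. unfold T7_holds; reading. Qed.
Lemma sat_T8 r : sat M r T8 <-> T8_holds. Proof. unfold T8_holds; reading. Qed.
Lemma sat_T9 r : sat M r T9 <-> T9_holds. Proof. unfold T9_holds; reading. Qed.
Lemma sat_T10 r : sat M r T10 <-> T10_holds. Proof. unfold T10_holds; reading. Qed.
Lemma sat_T11 r : sat M r T11 <-> T11_holds. Proof. unfold T11_holds; reading. Qed.
Lemma sat_T12 r : sat M r T12 <-> T12_holds. Proof. unfold T12_holds; reading. Qed.
Lemma sat_T13 r : sat M r T13 <-> T13_holds. Proof. unfold T13_holds; reading. Qed.
Lemma sat_T14 r : sat M r T14 <-> T14_holds. Proof. unfold T14_holds; reading. Qed.
Lemma sat_T15 r : sat M r T15 <-> T15_holds. Proof. unfold T15_holds; reading. Qed.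
Lemma sat_TRep r : sat M r TRep <-> TRep_holds. Proof. unfold TRep_holds; reading. Qed.

(** * Truth of quoted formulas *)

(** [M] with inner truth TT as the interpretation of T. *)
Definition inner : structure := {|
  dom := dom M; i_zero := i_zero M; i_un := i_un M; i_bin := i_bin M; i_sub := i_sub M;
  i_tr := TTof |}.

Section Truth.

Context (HT1 : T1_holds) (HT4 : T4_holds) (HT5 : T5_holds) (HT6 : T6_holds) (HR1 : R1_holds).

Lemma tru_neg x : sent x -> (tru (kNeg x) <-> ~ tru x).
Proof. intros H. rewrite <- neg_def by exact H. now apply HT4. Qed.

Lemma tru_conj x y : sent x -> sent y -> (tru (kConj x y) <-> tru x /\ tru y).
Proof. intros H H'. rewrite <- conj_def. now apply HT5. Qed.

Lemma form1_tr f : form1 0 (kTr (kVar 0)) /\ form1 0 (kTr (kUn f (kVar 0))).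
Proof.
  split; (split; [now syn|]); intros w; syn; intros N; apply NNPP; intros N';
    apply N, occ_var_other; auto.
Qed.

(** The terms [t] and [num y] have the same value, so regularity applies to the
formula T(v), and below to the formula F(v). *)
Lemma TTtm_val t y : clTerm t -> val t y -> (TTtm t <-> TTof y).
Proof.
  intros H H'. unfold TTof, TTtm. rewrite !tdot_def.
  assert (K := HR1 0 _ (proj1 (form1_tr sS)) t H y H' _ (num_closed y) y (num_val y) eq_refl).
  revert K; syn. auto.
Qed.

Lemma TFtm_val t y : clTerm t -> val t y -> (TFtm t <-> TFof y).
Proof.
  intros H H'. unfold TFof, TFtm.
  assert (K := HR1 0 _ (proj2 (form1_tr sNeg)) t H y H' _ (num_closed y) y (num_val y) eq_refl).
  revert K; syn. auto.
Qed.

(** F(num x) is T applied to a term whose value is the negation of [x]. *)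
Lemma TFof_neg x : TFof x <-> TTof (dotNeg x).
Proof.
  rewrite <- (TTtm_val (kUn sNeg (num x))).
  - unfold TFof, TFtm, TTtm. now rewrite tdot_def.
  - apply clTerm_un, num_closed.
  - apply val_un, num_val.
Qed.

Lemma eval_inner r t : eval inner r t = eval M r t.
Proof. induction t; cbn; congruence. Qed.

(** Induction on the standard formula [A].  At an atom T(t) the code states TT of the
value of t; at a quantifier every element is the value of its numeral, and every
closed term has a value. *)
Lemma tru_qform A : forall s (r : nat -> dom M), closes s -> (forall i, val (s i) (r i)) ->
  (tru (qform s O A) <-> sat inner r A).
Proof.
  induction A as [a b|a|A IH|A IHA B IHB|A IH]; intros s r Hs Hr; cbn [qform sat].
  - rewrite !eval_inner, <- eqn_def.
    apply HT1; auto using clTerm_qterm, val_qterm.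
  - rewrite eval_inner. cbn [i_tr inner]. rewrite <- (TTtm_val (qterm s O a)).
    + unfold TTtm. now rewrite tdot_def.
    + now apply clTerm_qterm.
    + now apply val_qterm.
  - rewrite tru_neg by now apply sent_qform. now rewrite (IH s r).
  - rewrite tru_conj by now apply sent_qform. now rewrite (IHA s r), (IHB s r).
  - rewrite <- all_def, (HT6 _ (form1_qform s A Hs)).
    assert (forall u, subs (qform s 1%nat A) 0 u = qform (scons u s) O A) as E
      by exact (fun u => sub_qform s A u Hs O).
    split.
    + intros H x. specialize (H (num x) (num_closed x)).
      rewrite E in H. revert H. apply IH.
      * apply closes_scons; auto using num_closed.
      * intros [|i]; cbn; auto using num_val.
    + intros H t Ht. destruct (val_total t Ht) as [y Hy].
      rewrite E. apply (IH _ (scons y r)); auto.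
      * now apply closes_scons.
      * intros [|i]; cbn; auto.
Qed.

(* Both structures have the same operations. *)
Ltac inner_reading :=
  unfold clTerm, kTr, kUn, pair; change (nm M) with (nm inner);
  change (i_un M) with (i_un inner); change (i_bin M) with (i_bin inner);
  change (i_sub M) with (i_sub inner); change (i_zero M) with (i_zero inner);
  change TTof with (i_tr inner); change (dom M) with (dom inner); sem.

Lemma tru_all_instances x :
  tru (qform (fun _ => num x) O all_instances_true)
  <-> forall t, clTerm t -> TTof (subs x 0 t).
Proof.
  rewrite (tru_qform _ _ (fun _ => x)).
  - unfold all_instances_true. inner_reading.
  - intros i; apply num_closed.
  - intros i; apply num_val.
Qed.

Lemma tru_some_instance x :
  tru (qform (fun _ => num x) O some_instance_false)
  <-> exists t, clTerm t /\ TFof (subs x 0 t).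
Proof.
  rewrite (tru_qform _ _ (fun _ => x)).
  - transitivity (exists t, clTerm t /\ TTof (dotNeg (subs x 0 t))).
    + unfold some_instance_false. inner_reading.
    + split; intros (t & H & K); exists t; split; auto; now apply TFof_neg.
  - intros i; apply num_closed.
  - intros i; apply num_val.
Qed.

Lemma tru_code_det t y : clTerm t -> val t y ->
  (tru (code_det t) <-> ~ TTof (kTr (num y)) \/ ~ TTof (kTr (kUn sNeg (num y)))).
Proof.
  intros H H'. unfold code_det. rewrite (tru_qform _ _ (fun _ => y)) by (intros i; assumption).
  rewrite <- tdot_def. inner_reading.
Qed.

Lemma sent_dotNeg x : sent x -> sent (dotNeg x).
Proof. intros H. rewrite neg_def; auto using sent_neg. Qed.

(** * From Kripke-Feferman truth to determinateness *)

Section FromCKF.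

Context (HT7 : T7_holds) (HT8 : T8_holds) (HT9 : T9_holds) (HT10 : T10_holds)
  (HT11 : T11_holds) (HT12 : T12_holds) (HT13 : T13_holds) (HT14 : T14_holds)
  (HT15 : T15_holds) (HTRep : TRep_holds).

Lemma tru_TTof x : tru x -> TTof x.
Proof. exact (HTRep (num x) (num_closed x) x (num_val x)). Qed.

(** The negation function takes every other number to the code of 0 = 0. *)
Lemma not_sent_TFof x : ~ sent x -> TFof x.
Proof.
  intros H. rewrite TFof_neg, neg_default, <- eqn_def by exact H.
  assert (clTerm kZero) as K by (rewrite <- num_zero; apply num_closed).
  now apply (HT7 _ K 0 val_zero _ K 0 val_zero).
Qed.

Lemma TTof_or_TFof x : TTof x \/ TFof x.
Proof.
  destruct (classic (sent x)) as [H|H]; [|right; now apply not_sent_TFof].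
  destruct (classic (tru x)) as [K|K]; [left; now apply tru_TTof|right].
  rewrite TFof_neg. now apply tru_TTof, HT4.
Qed.

(** If TT x but not T x, then T(not x), hence TF x by [tru_TTof], and x is not
determinate; if x is not a sentence, TF x holds anyway. *)
Lemma det_TTof x : det x -> (TTof x <-> tru x).
Proof.
  intros H; split; [|apply tru_TTof]. intros HT. destruct H as [H|H]; [contradiction|].
  destruct (classic (sent x)) as [Hs|Hs]; [|destruct H; now apply not_sent_TFof].
  apply NNPP; intros N. apply H. rewrite TFof_neg. now apply tru_TTof, HT4.
Qed.

Lemma TFof_dotNeg x : sent x -> (TFof (dotNeg x) <-> TTof x).
Proof. intros H. rewrite TFof_neg. symmetry; now apply HT9. Qed.

Lemma TTof_tr t y : clTerm t -> val t y -> (TTof (kTr t) <-> TTof y).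
Proof. intros H H'. rewrite <- tdot_def, (HT14 t H). now apply TTtm_val. Qed.

Lemma TFof_tr t y : clTerm t -> val t y -> (TFof (kTr t) <-> TFof y).
Proof. intros H H'. rewrite <- tdot_def, (HT15 t H). now apply TFtm_val. Qed.

Lemma CKF_T2 : T2_holds.
Proof.
  intros t H y H'. rewrite (tru_code_det t y H H').
  rewrite (TTof_tr (num y) y), (TTof_tr (kUn sNeg (num y)) (dotNeg y)), <- TFof_neg;
    auto using num_closed, num_val, clTerm_un, val_un. reflexivity.
Qed.

Lemma CKF_T3 : T3_holds.
Proof. intros t H y H' Hd. rewrite (TTtm_val t y H H'). now apply det_TTof. Qed.

Lemma CKF_D1 : D1_holds.
Proof.
  intros s Hs t Ht. destruct (val_total s Hs) as [y Hy], (val_total t Ht) as [z Hz].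
  unfold det. rewrite (HT7 s Hs y Hy t Ht z Hz), (HT8 s Hs y Hy t Ht z Hz).
  destruct (classic (y = z)); tauto.
Qed.

Lemma CKF_D2 : D2_holds.
Proof.
  intros t H y H'. unfold det. now rewrite tdot_def, (TTof_tr t y), (TFof_tr t y).
Qed.

(** The code of D t is a disjunction of negated atoms T(a), T(b) where the values of
[a] and [b] are the codes of T and F applied to the numeral of [y], so the clauses for
inner truth evaluate it.  The result is that TT(D t) always holds, by [TTof_or_TFof],
and that TF(D t) holds iff TT y and TF y do. *)
Lemma CKF_D3 : D3_holds.
Proof.
  intros t H y H'.
  set (s := fun _ : nat => t).
  assert (closes s) as Hs by (intros i; exact H).
  assert (forall u, val (qterm s O u) (eval M (fun _ => y) u)) as Hv.
  { intros u; apply val_qterm; intros i; exact H'. }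
  set (a := qterm s O (Un sTdot (Un sNum (Var O)))).
  set (b := qterm s O (Bin sPair (numeral tag_tr)
              (Bin sPair (numeral (tag_un sNeg)) (Un sNum (Var O))))).
  assert (clTerm a) as Ha by now apply clTerm_qterm.
  assert (clTerm b) as Hb by now apply clTerm_qterm.
  assert (val a (kTr (num y))) as Va by (rewrite <- tdot_def; apply Hv).
  assert (val b (kTr (kUn sNeg (num y)))) as Vb by apply Hv.
  assert (clTerm (kUn sNeg (num y))) as Hn by apply clTerm_un, num_closed.
  assert (val (kUn sNeg (num y)) (dotNeg y)) as Vn by apply val_un, num_val.
  assert (TTof (kTr a) <-> TTof y) as TTa.
  { rewrite (TTof_tr a _ Ha Va). apply TTof_tr; auto using num_closed, num_val. }
  assert (TFof (kTr a) <-> TFof y) as TFa.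
  { rewrite (TFof_tr a _ Ha Va). apply TFof_tr; auto using num_closed, num_val. }
  assert (TTof (kTr b) <-> TFof y) as TTb.
  { rewrite (TTof_tr b _ Hb Vb), TFof_neg. now apply TTof_tr. }
  assert (TFof (kTr b) <-> TFof (dotNeg y)) as TFb.
  { rewrite (TFof_tr b _ Hb Vb). now apply TFof_tr. }
  assert (sent (kTr a)) as Sa by now apply sent_tr.
  assert (sent (kTr b)) as Sb by now apply sent_tr.
  assert (code_det t = dotNeg (dotConj (dotNeg (dotNeg (kTr a))) (dotNeg (dotNeg (kTr b))))) as E.
  { rewrite conj_def, (neg_def (kTr a)), (neg_def (kTr b)), (neg_def (kNeg (kTr a))),
      (neg_def (kNeg (kTr b))), neg_def by auto using sent_neg, sent_conj. reflexivity. }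
  set (A := dotNeg (dotNeg (kTr a))) in *. set (B := dotNeg (dotNeg (kTr b))) in *.
  assert (sent A) as SA by (unfold A; auto using sent_dotNeg).
  assert (sent B) as SB by (unfold B; auto using sent_dotNeg).
  assert (sent (dotConj A B)) as SAB by (rewrite conj_def; now apply sent_conj).
  unfold det. rewrite E, <- TFof_neg, (TFof_dotNeg _ SAB), (HT10 A SA B SB), (HT11 A SA B SB).
  unfold A, B. rewrite !TFof_dotNeg, <- !TFof_neg, !TFof_dotNeg by auto using sent_dotNeg.
  rewrite TFa, TFb, TTa, TTb.
  destruct (TTof_or_TFof y) as [K|K]; [|tauto].
  destruct (classic (sent y)) as [Sy|Sy].
  - rewrite (TFof_dotNeg y Sy); tauto.
  - assert (TFof y) by now apply not_sent_TFof. tauto.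
Qed.

Lemma CKF_D4 : D4_holds.
Proof. intros x H. unfold det. rewrite <- TFof_neg, (TFof_dotNeg x H). tauto. Qed.

(** This turns the second and third disjuncts of D5 and the second of D6 into
statements about inner truth. *)
Lemma det_refuted x : sent x -> (det x /\ tru (dotNeg x) <-> ~ TTof x).
Proof.
  intros H. rewrite (HT4 x H). split.
  - intros [Hd N] HT. now apply N, det_TTof.
  - intros N. split; [now left|]. intros HT; now apply N, tru_TTof.
Qed.

Lemma CKF_D5 : D5_holds.
Proof.
  intros x H y H'. rewrite !det_refuted by assumption. unfold det.
  rewrite (HT10 x H y H'), (HT11 x H y H').
  destruct (classic (TTof x)), (classic (TTof y)); tauto.
Qed.

Lemma TTof_all x : form1 0 x -> (TTof (kAll x) <-> forall t, clTerm t -> TTof (subs x 0 t)).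
Proof. intros H. rewrite <- all_def, (HT12 x H). apply tru_all_instances. Qed.

Lemma TFof_all x : form1 0 x ->
  (TFof (kAll x) <-> exists t, clTerm t /\ TFof (subs x 0 t)).
Proof. intros H. rewrite <- all_def, (HT13 x H). apply tru_some_instance. Qed.

Lemma CKF_D6 : D6_holds.
Proof.
  intros x H. rewrite all_def. unfold det at 1. rewrite (TTof_all x H), (TFof_all x H).
  assert ((exists t, clTerm t /\ det (subs x 0 t) /\ tru (dotNeg (subs x 0 t)))
    <-> exists t, clTerm t /\ ~ TTof (subs x 0 t)) as E.
  { split; intros (t & Ht & K); exists t; split; auto;
      apply det_refuted; auto using sent_subst. }
  rewrite E. split.
  - intros [N|N].
    + right. apply NNPP; intros N'; apply N; intros t Ht. apply NNPP; eauto.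
    + left. intros t Ht; right; eauto.
  - intros [K|(t & Ht & N)]; [|left; auto].
    destruct (classic (forall t, clTerm t -> TTof (subs x 0 t))) as [A|A]; [right|now left].
    intros (t & Ht & HF). destruct (K t Ht); auto.
Qed.

(** If only [v] is free in the quantified formula, then only 0 and [nS v] are free in
its body; this lemma and the next replace one of the two by a closed term. *)
Lemma form1_under_all v x t : form1 v (kAll x) -> clTerm t -> form1 (nS v) (subs x 0 t).
Proof.
  intros [H K] [Ht Ht']. syn_in H. split; [now apply fm_subst|].
  intros w N. destruct (classic (w = 0)) as [->|W].
  - destruct N. now apply occ_sub_same.
  - rewrite occ_sub_other in N by assumption.
    destruct (zero_or_S w) as [->|[u ->]]; [contradiction|]. f_equal. apply K. now syn.
Qed.

Lemma form1_body v x t : form1 v (kAll x) -> clTerm t -> form1 0 (subs x (nS v) t).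
Proof.
  intros [H K] [Ht Ht']. syn_in H. split; [now apply fm_subst|].
  intros w N. destruct (zero_or_S w) as [->|[u ->]]; auto.
  destruct (classic (u = v)) as [->|U].
  - destruct N. now apply occ_sub_same.
  - rewrite occ_sub_other in N by (auto; intros E; now apply S_inj in E).
    destruct U. apply K. now syn.
Qed.

Lemma TTof_eqn s t : sent (kEqn s t) -> (TTof (kEqn s t) <-> tru (kEqn s t)).
Proof.
  intros [Hs Ht]%sent_eqn_inv.
  destruct (val_total s Hs) as [y Hy], (val_total t Ht) as [z Hz]. rewrite <- eqn_def.
  now rewrite (HT7 s Hs y Hy t Ht z Hz), (HT1 s Hs y Hy t Ht z Hz).
Qed.

Lemma TFof_eqn s t : sent (kEqn s t) -> (TFof (kEqn s t) <-> ~ tru (kEqn s t)).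
Proof.
  intros [Hs Ht]%sent_eqn_inv.
  destruct (val_total s Hs) as [y Hy], (val_total t Ht) as [z Hz]. rewrite <- eqn_def.
  now rewrite (HT8 s Hs y Hy t Ht z Hz), (HT1 s Hs y Hy t Ht z Hz).
Qed.

(** Regularity of inner truth is not an axiom; it holds for atoms by regularity
of outer truth and is preserved by the compositional clauses.  Instances of [x]
can have larger codes than [x], hence the induction is on depth. *)
Lemma inner_regular n : forall x, depth x n -> forall v, form1 v x ->
  forall s t y, clTerm s -> clTerm t -> val s y -> val t y ->
  (TTof (subs x v s) <-> TTof (subs x v t)) /\ (TFof (subs x v s) <-> TFof (subs x v t)).
Proof.
  pattern n; revert n; apply strong_induction; [definability|].
  intros n IH x Hx v H s t y Hs Ht Vs Vt.
  assert (sent (subs x v s)) as Ss by now apply sent_subst.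
  assert (sent (subs x v t)) as St by now apply sent_subst.
  assert (tru (subs x v s) <-> tru (subs x v t)) as R
    by exact (HR1 v x H s Hs y Vs t Ht y Vt eq_refl).
  apply (generated_inv _ depthClause_mono) in Hx.
  destruct Hx as [(a&b&->)|[(a&->)|[(z&m&->&L&K)|[(z&w&m&k&->&L&L'&K&K')|(z&m&->&L&K)]]]].
  - rewrite !sub_eqn in *. rewrite !TTof_eqn, !TFof_eqn by assumption. tauto.
  - assert (form1 v (kTr (kUn sNeg a))) as H'.
    { destruct H as [H1 H2]; syn_in H1. split; [now syn|]. intros w; syn.
      intros N; apply H2; now syn. }
    assert (R' := HR1 v _ H' s Hs y Vs t Ht y Vt eq_refl). revert R'.
    rewrite !sub_tr in *.
    apply sent_tr_inv in Ss, St. rewrite <- !tdot_def in *.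
    rewrite (HT14 _ Ss), (HT14 _ St), (HT15 _ Ss), (HT15 _ St).
    unfold TTtm, TFtm. rewrite !tdot_def in *. rewrite !sub_un. tauto.
  - assert (form1 v z) as Hz.
    { destruct H as [H1 H2]; syn_in H1. split; auto. intros w N; apply H2; now syn. }
    destruct (IH m L z K v Hz s t y Hs Ht Vs Vt) as [E E'].
    rewrite !sub_neg in *. apply sent_neg_inv in Ss, St.
    rewrite <- !neg_def by assumption. rewrite <- !TFof_neg, !TFof_dotNeg by assumption. tauto.
  - assert (form1 v z /\ form1 v w) as [Hz Hw].
    { destruct H as [H1 H2]; syn_in H1. apply mul_eq_one in H1 as [? ?].
      split; (split; auto); intros u N; apply H2; syn; intros N'; split_occ; auto. }
    destruct (IH m L z K v Hz s t y Hs Ht Vs Vt) as [E1 E1'].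
    destruct (IH k L' w K' v Hw s t y Hs Ht Vs Vt) as [E2 E2'].
    rewrite !sub_conj in *. apply sent_conj_inv in Ss as [Sz Sw], St as [Sz' Sw'].
    rewrite <- !conj_def, (HT10 _ Sz _ Sw), (HT10 _ Sz' _ Sw'), (HT11 _ Sz _ Sw), (HT11 _ Sz' _ Sw').
    tauto.
  - assert (forall u, clTerm u ->
      (TTof (subs (subs z (nS v) s) 0 u) <-> TTof (subs (subs z (nS v) t) 0 u))
      /\ (TFof (subs (subs z (nS v) s) 0 u) <-> TFof (subs (subs z (nS v) t) 0 u))) as E.
    { intros u Hu. rewrite !(sub_swap z (nS v) 0 _ u) by (apply S_zero || apply Hs || apply Ht || apply Hu).
      apply (IH m L _ (depth_subst m z 0 u K) _ (form1_under_all v z u H Hu) s t y); auto. }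
    rewrite !sub_all, !TTof_all, !TFof_all by auto using form1_body.
    split; split.
    + intros A u Hu; apply E; auto.
    + intros A u Hu; apply E; auto.
    + intros (u & Hu & A); exists u; split; auto; apply E; auto.
    + intros (u & Hu & A); exists u; split; auto; apply E; auto.
Qed.

Lemma CKF_R2 : R2_holds.
Proof.
  intros v x H s Hs y Vs t Ht z Vt <-.
  destruct (inner_regular x x (depth_total x (proj1 H)) v H s t y Hs Ht Vs Vt) as [E E'].
  unfold det. now rewrite E, E'.
Qed.

End FromCKF.

(** * From determinateness to Kripke-Feferman truth *)

Section FromCD.

Context (HT3 : T3_holds) (HD1 : D1_holds) (HD2 : D2_holds) (HD4 : D4_holds)
  (HD5 : D5_holds) (HD6 : D6_holds).

Lemma det_TT x : det x -> (TTof x <-> tru x).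
Proof. exact (HT3 (num x) (num_closed x) x (num_val x)). Qed.

Lemma det_TF x : sent x -> det x -> (TFof x <-> ~ tru x).
Proof.
  intros H Hd. rewrite TFof_neg, <- (HT4 x H). apply det_TT. now apply HD4.
Qed.

Lemma not_det x : ~ det x -> TTof x /\ TFof x.
Proof. unfold det. intros N; split; apply NNPP; tauto. Qed.

Lemma CD_T7 : T7_holds.
Proof.
  intros s Hs y Vs t Ht z Vt. rewrite det_TT by now apply HD1. now apply HT1.
Qed.

Lemma CD_T8 : T8_holds.
Proof.
  intros s Hs y Vs t Ht z Vt. rewrite det_TF.
  - now rewrite (HT1 s Hs y Vs t Ht z Vt).
  - rewrite eqn_def; now apply sent_eqn.
  - now apply HD1.
Qed.

Lemma CD_T9 : T9_holds.
Proof.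
  intros x H. rewrite <- TFof_neg.
  destruct (classic (det x)) as [K|K].
  - rewrite det_TT, det_TF, (HT4 x H); auto using sent_dotNeg; [|now apply HD4].
    destruct (classic (tru x)); tauto.
  - apply not_det in K as K'. rewrite <- (HD4 x H) in K. apply not_det in K. tauto.
Qed.

(** In the determinate case D5 leaves only situations where the conjuncts are
determinate or one is determinately false; otherwise each conjunct is glutty or
true, and each side of T10 holds. *)
Lemma CD_T10 : T10_holds.
Proof.
  intros x H y H'. assert (E := HD5 x H y H'). rewrite (HT4 x H), (HT4 y H') in E.
  assert (Ex := det_TT x). assert (Ey := det_TT y).
  assert (Nx := not_det x). assert (Ny := not_det y).
  destruct (classic (det (dotConj x y))) as [K|K].
  - rewrite (det_TT _ K), (HT5 x H y H').
    destruct (classic (det x)), (classic (det y)); tauto.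
  - apply not_det in K as K'.
    destruct (classic (det x)), (classic (det y)), (classic (tru x)), (classic (tru y)); tauto.
Qed.

Lemma CD_T11 : T11_holds.
Proof.
  intros x H y H'. assert (E := HD5 x H y H'). rewrite (HT4 x H), (HT4 y H') in E.
  assert (Ex := det_TF x H). assert (Ey := det_TF y H').
  assert (Nx := not_det x). assert (Ny := not_det y).
  destruct (classic (det (dotConj x y))) as [K|K].
  - rewrite det_TF, (HT5 x H y H'); auto; [|rewrite conj_def; now apply sent_conj].
    destruct (classic (det x)), (classic (det y)), (classic (tru x)), (classic (tru y)); tauto.
  - apply not_det in K as K'. destruct (classic (det x)), (classic (det y)); tauto.
Qed.

(** If neither disjunct of D6 holds, every instance that is determinate is true, and
some instance is not determinate. *)
Lemma det_not_all x : form1 0 x -> ~ det (dotAll x) ->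
  (forall t, clTerm t -> TTof (subs x 0 t)) /\ (exists t, clTerm t /\ TFof (subs x 0 t)).
Proof.
  intros H N. rewrite (HD6 x H) in N. apply not_or_and in N as [N1 N2]. split.
  - intros t Ht. destruct (classic (det (subs x 0 t))) as [K|K]; [|now apply not_det].
    apply det_TT; auto. apply NNPP; intros N. apply N2. exists t.
    split; [exact Ht|split; [exact K|]]. apply HT4; auto using sent_subst.
  - apply NNPP; intros N. apply N1. intros t Ht. apply NNPP; intros K.
    apply N; exists t. split; auto. now apply not_det.
Qed.

Lemma CD_T12 : T12_holds.
Proof.
  intros x H. rewrite tru_all_instances.
  destruct (classic (det (dotAll x))) as [K|K].
  - rewrite (det_TT _ K), (HT6 x H). apply (HD6 x H) in K as [K|(t & Ht & K & N)].
    + split; intros A t Ht; apply (det_TT _ (K t Ht)); auto.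
    + apply HT4 in N; [|now apply sent_subst].
      split; intros A; destruct N; auto. now apply det_TT; auto.
  - apply not_det in K as K'. apply det_not_all in K as [K _]; tauto.
Qed.

Lemma CD_T13 : T13_holds.
Proof.
  intros x H. rewrite tru_some_instance.
  destruct (classic (det (dotAll x))) as [K|K].
  - rewrite det_TF, (HT6 x H); auto; [|rewrite all_def; now apply sent_all].
    apply (HD6 x H) in K as [K|(t & Ht & K & N)].
    + split.
      * intros A. apply NNPP; intros N. apply A; intros t Ht. apply NNPP; intros B.
        apply N; exists t; split; auto. apply det_TF; auto using sent_subst.
      * intros (t & Ht & B) A. apply det_TF in B; auto using sent_subst.
    + apply HT4 in N; [|now apply sent_subst].
      split; auto. intros _; exists t; split; auto. apply det_TF; auto using sent_subst.
  - apply not_det in K as K'. apply det_not_all in K as [_ K]; tauto.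
Qed.

Lemma CD_T14 : T14_holds.
Proof.
  intros t Ht. destruct (val_total t Ht) as [y Hy].
  assert (det (dotT t) <-> det y) as E by exact (HD2 t Ht y Hy). rewrite (TTtm_val t y Ht Hy).
  destruct (classic (det y)) as [K|K].
  - rewrite det_TT by tauto. apply (TTtm_val t y Ht Hy).
  - apply not_det in K as K'. assert (~ det (dotT t)) as N by tauto.
    apply not_det in N. tauto.
Qed.

Lemma CD_T15 : T15_holds.
Proof.
  intros t Ht. destruct (val_total t Ht) as [y Hy].
  assert (det (dotT t) <-> det y) as E by exact (HD2 t Ht y Hy). rewrite (TFtm_val t y Ht Hy).
  destruct (classic (det y)) as [K|K].
  - rewrite det_TF by (tauto || (rewrite tdot_def; now apply sent_tr)).
    change (~ TTtm t <-> TFof y). rewrite (TTtm_val t y Ht Hy).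
    destruct (classic (sent y)) as [S|S].
    + now rewrite (det_TT y K), det_TF.
    (* Since TF y holds, determinateness of y means that TT y fails. *)
    + assert (TFof y) as HF.
      { rewrite TFof_neg, neg_default, <- eqn_def by exact S.
        assert (clTerm kZero) as C by (rewrite <- num_zero; apply num_closed).
        now apply (CD_T7 _ C 0 val_zero _ C 0 val_zero). }
      destruct K; tauto.
  - apply not_det in K as K'. assert (~ det (dotT t)) as N by tauto.
    apply not_det in N. tauto.
Qed.

Lemma CD_TRep : TRep_holds.
Proof.
  intros t Ht y Hy H. rewrite (TTtm_val t y Ht Hy).
  destruct (classic (det y)) as [K|K]; [now apply det_TT|now apply not_det].
Qed.

End FromCD.

End Truth.

End Model.

(** * The theories prove the same sentences *)

Fixpoint term_belowb (n : nat) (t : term) : bool :=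
  match t with
  | Var i => i <? n
  | Zero => true
  | Un _ a => term_belowb n a
  | Bin _ a b => term_belowb n a && term_belowb n b
  | Sub a b c => term_belowb n a && (term_belowb n b && term_belowb n c)
  end.

Fixpoint form_belowb (n : nat) (A : form) : bool :=
  match A with
  | Eqn a b => term_belowb n a && term_belowb n b
  | Tr a => term_belowb n a
  | Neg A => form_belowb n A
  | Conj A B => form_belowb n A && form_belowb n B
  | All A => form_belowb (S n) A
  end.

Lemma term_belowb_sound n t : term_belowb n t = true -> term_below n t.
Proof.
  induction t; cbn -[Nat.ltb]; rewrite ?andb_true_iff; try tauto.
  apply Nat.ltb_lt.
Qed.

Lemma sentence_by_computation A : form_belowb 0 A = true -> sentence A.
Proof.
  unfold sentence. generalize 0. induction A; intros n; cbn; rewrite ?andb_true_iff;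
    intuition auto using term_belowb_sound.
Qed.

Lemma PA_sentence A : PA A -> sentence A.
Proof.
  destruct 1; try assumption; try destruct f;
    apply sentence_by_computation; vm_compute; reflexivity.
Qed.

Lemma CDplus_sentence A : CDplus A -> sentence A.
Proof.
  intros [H|H]; [now apply PA_sentence|]. revert A H. apply Forall_forall.
  repeat constructor; apply sentence_by_computation; vm_compute; reflexivity.
Qed.

Lemma CKF_sentence A : CKF A -> sentence A.
Proof.
  intros [H|H]; [now apply PA_sentence|]. revert A H. apply Forall_forall.
  repeat constructor; apply sentence_by_computation; vm_compute; reflexivity.
Qed.

Lemma CKF_models_CDplus M : models M CKF -> models M CDplus.
Proof.
  intros H.
  assert (HPA : models M PA) by (intros A HA; apply H; now left).
  set (r0 := fun _ : nat => i_zero M).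
  assert (HL : Forall (sat M r0) [T1; T4; T5; T6; R1;
    T7; T8; T9; T10; T11; T12; T13; T14; T15; TRep]).
  { apply Forall_forall. intros A HA; apply H; now right. }
  repeat match goal with HL : Forall _ (_ :: _) |- _ =>
    apply Forall_cons_iff in HL as [? HL] end. clear HL.
  rewrite sat_T1, sat_T4, sat_T5, sat_T6, sat_R1, sat_T7, sat_T8, sat_T9, sat_T10, sat_T11,
    sat_T12, sat_T13, sat_T14, sat_T15, sat_TRep in *.
  intros A [HA|HA] r; [now apply HPA|].
  repeat destruct HA as [<-|HA]; [..|destruct HA].
  all: rewrite ?sat_T1, ?sat_T2, ?sat_T3, ?sat_T4, ?sat_T5, ?sat_T6, ?sat_D1, ?sat_D2, ?sat_D3,
    ?sat_D4, ?sat_D5, ?sat_D6, ?sat_R1, ?sat_R2.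
  all: eauto using CKF_T2, CKF_T3, CKF_D1, CKF_D2, CKF_D3, CKF_D4, CKF_D5, CKF_D6, CKF_R2.
Qed.

Lemma CDplus_models_CKF M : models M CDplus -> models M CKF.
Proof.
  intros H.
  assert (HPA : models M PA) by (intros A HA; apply H; now left).
  set (r0 := fun _ : nat => i_zero M).
  assert (HL : Forall (sat M r0) [T1; T2plus; T3; T4; T5; T6; D1; D2; D3; D4; D5; D6; R1; R2]).
  { apply Forall_forall. intros A HA; apply H; now right. }
  repeat match goal with HL : Forall _ (_ :: _) |- _ =>
    apply Forall_cons_iff in HL as [? HL] end. clear HL.
  rewrite sat_T1, sat_T2, sat_T3, sat_T4, sat_T5, sat_T6, sat_D1, sat_D2, sat_D3, sat_D4, sat_D5,
    sat_D6, sat_R1, sat_R2 in *.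
  intros A [HA|HA] r; [now apply HPA|].
  repeat destruct HA as [<-|HA]; [..|destruct HA].
  all: rewrite ?sat_T1, ?sat_T4, ?sat_T5, ?sat_T6, ?sat_R1, ?sat_T7, ?sat_T8, ?sat_T9, ?sat_T10,
    ?sat_T11, ?sat_T12, ?sat_T13, ?sat_T14, ?sat_T15, ?sat_TRep.
  all: eauto using CD_T7, CD_T8, CD_T9, CD_T10, CD_T11, CD_T12, CD_T13, CD_T14, CD_T15, CD_TRep.
Qed.
(** By soundness and completeness it is enough that every model of the second
theory is a model of the first. *)
Lemma proves_transfer (Th Th' : theory) A : (forall B, Th' B -> sentence B) ->
  (forall M, models M Th' -> models M Th) -> sentence A -> proves Th A -> proves Th' A.
Proof.
  intros C H HA (G & HG & HP). apply completeness; auto.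
  intros M HM r. apply (soundness _ _ HP). intros B HB. now apply H, HG.
Qed.

Theorem mainTheorem7 (A : form) (hA : sentence A) : proves CDplus A <-> proves CKF A.
Proof.
  split; apply proves_transfer;
    auto using CDplus_sentence, CKF_sentence, CDplus_models_CKF, CKF_models_CDplus.
Qed.
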